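(* Let $p$ be an odd prime and $n\ge1$. Define an auxiliary grading on the polynomial algebra $D_n$ by declaring each Dickson generator $Q_{n,s}$ $(0\le s<n)$ to have degree $1$. For $d\ge 0$, let $D_n^{\langle d\rangle}$ denote the homogeneous piece of auxiliary degree $d$. Then $D_n=\bigoplus_{d\ge 0}D_n^{\langle d\rangle}$ and, for every $F\in D_n^{\langle d\rangle}$, $$\delta_n(F)=dF.$$ Consequently, for $\delta_n\colon D_n\to D_n$, $$\ker(\delta_n)=\bigoplus_{\substack{d\ge 0\\ p\mid d}}D_n^{\langle d\rangle},\qquad \mathrm{Im}(\delta_n)=\bigoplus_{\substack{d\ge 0\\ p\nmid d}}D_n^{\langle d\rangle}.$$ Moreover, for $\mathrm{St}^{\Delta_n}\colon D_n\to D_n$, $$\ker(\mathrm{St}^{\Delta_n})=\bigoplus_{\substack{d\ge 0\\ p\mid d}}D_n^{\langle d\rangle},\qquad \mathrm{Im}(\mathrm{St}^{\Delta_n})=Q_{n,0}\bigoplus_{\substack{d\ge 0\\ p\nmid d}}D_n^{\langle d\rangle}.$$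
   Context: Let $p$ be an odd prime, $n\ge 1$, and $P_n=\mathbb{F}_p[x_1,\dots,x_n]$. For integers $e_1,\dots,e_n\ge 0$ put $[e_1,\dots,e_n]:=\det\big(x_r^{p^{e_s}}\big)_{1\le r,s\le n}\in P_n$. Let $L_n=[0,1,\dots,n-1]$ and $L_{n,s}=[0,1,\dots,\widehat{s},\dots,n]$ for $0\le s<n$ (a hat means omission). The Dickson invariants are $Q_{n,s}=L_{n,s}/L_n$ $(0\le s<n)$; in particular $Q_{n,0}=L_n^{p-1}$. The Dickson algebra is $D_n=P_n^{\mathrm{GL}_n(\mathbb{F}_p)}=\mathbb{F}_p[Q_{n,0},\dots,Q_{n,n-1}]$, a polynomial algebra on these generators. $\mathrm{St}^{\Delta_n}$ denotes the Steenrod--Milnor operation dual to the monomial $\xi_n$ in Milnor's dual mod-$p$ Steenrod algebra. It acts on $P_n$ as the unique $\mathbb{F}_p$-linear derivation with $\mathrm{St}^{\Delta_n}(x_r)=x_r^{p^n}$ $(1\le r\le n)$, and it maps $D_n$ into $D_n$. On a localization of $D_n$, $\mathrm{St}^{\Delta_n}$ means the unique derivation extending $\mathrm{St}^{\Delta_n}|_{D_n}$. The normalized derivation is $\delta_n:=(-1)^nQ_{n,0}^{-1}\mathrm{St}^{\Delta_n}$ on $D_n[Q_{n,0}^{-1}]$; it maps $D_n$ into $D_n$, and here it is regarded as an operator on $D_n$. *)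

(* Defs.v *)
From mathcomp Require Export all_boot all_order all_algebra.
From mathcomp.multinomials Require Export mpoly.
From mathcomp Require Import ring.

Set Implicit Arguments.
Unset Strict Implicit.
Unset Printing Implicit Defensive.

Import GRing.Theory.
Local Open Scope ring_scope.
Local Open Scope quotient_scope.

Local Notation "x %:F" := (@FracField.tofrac _ x) : ring_scope.

Definition derivation (R : comNzRingType) (D : R -> R) : Prop :=
  {morph D : x y / x + y} /\ (forall x y, D (x * y) = D x * y + x * D y).

(* Quotient rule; [fracderE] shows that it does not depend on the chosen    *)
(* representative of the fraction.                                          *)
Definition fracder (R : idomainType) (D : R -> R)
    (x : {fraction R}) : {fraction R} :=
  let a := \n_(repr x) in let b := \d_(repr x) in
  (D a * b - a * D b)%:F / b%:F ^+ 2.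

Lemma frac_numden (R : idomainType) (x : {fraction R}) :
  x = (\n_(repr x))%:F / (\d_(repr x))%:F.
Proof.
set r := repr x; have d0 := denom_ratioP r.
apply: (canRL (mulfK _)); first by rewrite tofrac_eq0.
rewrite -[x]reprK -/r; unlock FracField.tofrac.
rewrite -[LHS]FracField.pi_mul; apply/eqmodP.
rewrite /= FracField.equivfE /FracField.mulf !numden_Ratio ?mulr1 ?oner_eq0 //.
by rewrite mulrC.
Qed.

Section QuotientRule.
Variables (F : fieldType) (a b c d a' b' c' d' : F).

Lemma quotient_ruleD : b != 0 -> d != 0 ->
  (((a' * d + a * d') + (c' * b + c * b')) * (b * d)
     - (a * d + c * b) * (b' * d + b * d')) / (b * d) ^+ 2
  = (a' * b - a * b') / b ^+ 2 + (c' * d - c * d') / d ^+ 2.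
Proof. by move=> b0 d0; field; rewrite b0 d0. Qed.

Lemma quotient_ruleM : b != 0 -> d != 0 ->
  ((a' * c + a * c') * (b * d) - (a * c) * (b' * d + b * d')) / (b * d) ^+ 2
  = (a' * b - a * b') / b ^+ 2 * (c / d) + a / b * ((c' * d - c * d') / d ^+ 2).
Proof. by move=> b0 d0; field; rewrite b0 d0. Qed.

Lemma quotient_ruleV : b != 0 -> (a' - a / b * b') / b = (a' * b - a * b') / b ^+ 2.
Proof. by move=> b0; field. Qed.

End QuotientRule.

Section FracDer.
Variables (R : idomainType) (D : R -> R).
Hypothesis derD : derivation D.

Lemma fracderE (a b : R) : b != 0 ->
  fracder D (a%:F / b%:F) = (D a * b - a * D b)%:F / b%:F ^+ 2.
Proof.
case: derD => _ DM b0; rewrite /fracder.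
set x := a%:F / b%:F; set n := \n_ _; set d := \d_ _.
have d0 : d != 0 by exact: denom_ratioP.
have Fb0 : b%:F != 0 by rewrite tofrac_eq0.
have Fd0 : d%:F != 0 by rewrite tofrac_eq0.
have e : a * d = n * b.
  apply/eqP; rewrite -tofrac_eq !tofracM; apply/eqP.
  have := frac_numden x; rewrite -/n -/d {1}/x => /eqP.
  by rewrite eqr_div // => /eqP.
have De : D a * d + a * D d = D n * b + n * D b by rewrite -!DM e.
apply/eqP; rewrite eqr_div ?expf_neq0 // -!tofracXn -!tofracM tofrac_eq.
apply/eqP.
have -> : (D n * d - n * D d) * b ^+ 2
  = d * b * (D n * b + n * D b) - d * (n * b) * D b - b * (n * b) * D d by ring.
by rewrite -De -e; ring.
Qed.

Lemma fracder_tofrac a : fracder D a%:F = (D a)%:F.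
Proof.
have D1 : D 1 = 0.
  case: derD => _ /(_ 1 1); rewrite !mulr1 mul1r => /eqP.
  by rewrite -subr_eq subrr eq_sym => /eqP.
rewrite -[a%:F]divr1 -tofrac1 fracderE ?oner_eq0 //.
by rewrite D1 mulr0 subr0 mulr1 tofrac1 expr1n divr1.
Qed.

Lemma fracder_derivation : derivation (fracder D).
Proof.
case: (derD) => DA DM; split=> x y.
all: rewrite (frac_numden x) (frac_numden y).
all: move: (repr x) (repr y) => r s.
all: have r0 := denom_ratioP r; have s0 := denom_ratioP s.
all: move: r0 s0; move: \n_r \d_r \n_s \d_s => a b c d b0 d0.
all: have Fb0 : b%:F != 0 by rewrite tofrac_eq0.
all: have Fd0 : d%:F != 0 by rewrite tofrac_eq0.
- rewrite addf_div // -!tofracM -tofracD !fracderE ?mulf_neq0 //.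
  by rewrite !(DA, DM) !(tofracB, tofracD, tofracM) quotient_ruleD.
rewrite mulf_div -!tofracM !fracderE ?mulf_neq0 //.
by rewrite !DM !(tofracB, tofracD, tofracM) quotient_ruleM.
Qed.

Lemma fracder_unique (E : {fraction R} -> {fraction R}) :
  derivation E -> (forall a, E a%:F = (D a)%:F) -> E =1 fracder D.
Proof.
move=> [_ EM] ED x; rewrite (frac_numden x); move: (repr x) => r.
have := denom_ratioP r; move: \n_r \d_r => a b b0.
have Fb0 : b%:F != 0 by rewrite tofrac_eq0.
rewrite fracderE //; set y := a%:F / b%:F.
have ey : y * b%:F = a%:F by rewrite /y divfK.
have := EM y b%:F; rewrite ey !ED => /eqP; rewrite -subr_eq => /eqP h.
by rewrite tofracB !tofracM -quotient_ruleV // h mulfK.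
Qed.

End FracDer.

Section DirectSum.
Variables (M : zmodType) (V : nat -> M -> Prop).

(* The internal sum of the [V d] over the indices [d] satisfying [I].       *)
Definition family_sum (I : pred nat) (x : M) : Prop :=
  exists N (y : nat -> M),
    (forall d, I d -> V d (y d)) /\ x = \sum_(0 <= d < N | I d) y d.

(* Directness of the whole family; it is inherited by every subfamily.      *)
Definition independent : Prop :=
  forall N (y : nat -> M), (forall d, V d (y d)) ->
    \sum_(0 <= d < N) y d = 0 -> forall d, (d < N)%N -> y d = 0.

End DirectSum.

Definition kernel_on (M : zmodType) (W : M -> Prop) (f : M -> M) (x : M) :=
  W x /\ f x = 0.

Definition image_on (M : zmodType) (W : M -> Prop) (f : M -> M) (y : M) :=
  exists2 x, W x & y = f x.

(* Everything lives in the fraction field of P_n, which *)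
(* contains P_n, D_n and D_n[Q_{n,0}^-1].                                    *)

Section Dickson.
Variables (p n : nat).

Local Notation P := {mpoly 'F_p[n]}.
Local Notation K := {fraction P}.

Definition bracket (e : 'I_n -> nat) : P :=
  \det (\matrix_(r < n, s < n) ('X_r : P) ^+ (p ^ e s)).

Definition dickson_L : P := bracket (fun j => j).

(* [bump s] enumerates 0, 1, 2, ... with [s] omitted. *)
Definition dickson_Ls (s : nat) : P := bracket (fun j => bump s j).

Definition dickson_Q (s : nat) : K := (dickson_Ls s)%:F / dickson_L%:F.

Definition GL_invariant (F : P) : Prop :=
  forall g : 'M['F_p]_n, g \in unitmx ->
    F \mPo [tuple \sum_(j < n) g i j *: ('X_j : P) | i < n] = F.

Definition dickson (x : K) : Prop := exists2 F : P, GL_invariant F & x = F%:F.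

(* The value of G(Q_{n,0}, ..., Q_{n,n-1}). *)
Definition dickson_eval (G : {mpoly 'F_p[n]}) : K :=
  mmap (fun c : 'F_p => (c%:MP : P)%:F) (fun s : 'I_n => dickson_Q s) G.

Definition dickson_piece (d : nat) (x : K) : Prop :=
  exists2 G : {mpoly 'F_p[n]}, G \is d.-homog & x = dickson_eval G.

(* The derivation with St 'X_r = 'X_r ^+ (p ^ n), unique by [St_poly_unique]; *)
(* [St] is its unique extension to K, see [fracder_tofrac],                  *)
(* [fracder_derivation] and [fracder_unique].                                *)
Definition St_poly (F : P) : P :=
  \sum_(r < n) ('X_r : P) ^+ (p ^ n) * F^`M(r).

Definition St (x : K) : K := fracder St_poly x.

Definition delta (x : K) : K := (-1) ^+ n * (dickson_Q 0)^-1 * St x.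

Lemma St_poly_derivation : derivation St_poly.
Proof.
split=> F G; rewrite /St_poly.
  by rewrite -big_split; apply: eq_bigr => r _; rewrite mderivD mulrDr.
rewrite mulr_suml mulr_sumr -big_split; apply: eq_bigr => r _ /=.
by rewrite mderivM; ring.
Qed.

Lemma St_polyZ c F : St_poly (c *: F) = c *: St_poly F.
Proof.
rewrite /St_poly scaler_sumr; apply: eq_bigr => r _.
by rewrite mderivZ scalerAr.
Qed.

Lemma St_polyX (r : 'I_n) : St_poly 'X_r = 'X_r ^+ (p ^ n).
Proof.
rewrite /St_poly (bigD1 r) //= big1 => [|s /negbTE sr].
  rewrite mderivX mnm1E eqxx scale1r addr0.
  suff -> : (U_(r) - U_(r))%MM = 0%MM by rewrite mpolyX0 mulr1.
  by apply/mnmP=> t; rewrite mnmBE mnm0E subnn.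
by rewrite mderivX mnm1E eq_sym sr scale0r mulr0.
Qed.

Lemma St_poly_unique (E : P -> P) : derivation E ->
  (forall c F, E (c *: F) = c *: E F) ->
  (forall r : 'I_n, E 'X_r = 'X_r ^+ (p ^ n)) -> E =1 St_poly.
Proof.
move=> [EA EM] EZ EX; have [SA SM] := St_poly_derivation.
have der1 (D : P -> P) : (forall x y, D (x * y) = D x * y + x * D y) -> D 1 = 0.
  move/(_ 1 1); rewrite !mulr1 mul1r => /eqP.
  by rewrite -subr_eq subrr eq_sym => /eqP.
have E0 : E 0 = 0 by rewrite -(scale0r (0 : P)) EZ !scale0r.
have S0 : St_poly 0 = 0 by rewrite -(scale0r (0 : P)) St_polyZ !scale0r.
elim/mpolyind => [|c m F _ _ ih]; first by rewrite E0 S0.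
rewrite EA SA EZ St_polyZ ih; congr (_ *: _ + _).
rewrite (mpolyXE_id _ m); apply: (big_ind (fun G => E G = St_poly G)).
- by rewrite der1 ?der1.
- by move=> G H eG eH; rewrite EM SM eG eH.
move=> i _; elim: (m i) => [|k ihk]; first by rewrite expr0 !der1.
by rewrite exprS EM SM ihk EX St_polyX.
Qed.

End Dickson.

(* Main.v *)
(* For 1 <= k <= n let D_k be the derivation x_r |-> x_r^(p^k) of P_n.  It only
   sees the column of exponent 0 of a Moore determinant, so for k < n it kills
   L_n and all the L_{n,s} except L_{n,k}, which goes to +-L_{n,0}, while
   D_n = St sends L_n to (-1)^(n-1) L_{n,0} and kills every L_{n,s}, s < n.
   Hence St(Q_s) = (-1)^n Q_0 Q_s, and Euler's formula gives delta F = d F.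

   Independence: D_1, ..., D_n applied to a relation of least degree among the
   Q_s show that all its partial derivatives are relations, hence vanish; so it
   is a p-th power, whose root is a smaller relation.

   Generation, by induction on n and on the degree.  Let F be invariant.
   Invariance under x_j |-> x_j + x_1 kills the derivatives of F|_{x_1 = 0}, so
   this restriction is H^p with H invariant in n - 1 variables; as Q_{n,s+1}
   restricts to Q_{n-1,s}^p, some polynomial in the Q_{n,s} has the restriction
   H^p.  The difference with F is divisible by x_1, hence, by invariance, by
   L_n^(p-1) = Q_{n,0}, and the quotient is an invariant of lower degree. *)

Require Import Defs.
From HB Require Import structures.
From mathcomp Require Import perm finfield zify ring.

Set Implicit Arguments.
Unset Strict Implicit.
Unset Printing Implicit Defensive.

Import GRing.Theory.
Local Open Scope ring_scope.

Local Notation "x %:F" := (@FracField.tofrac _ x) : ring_scope.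

(** * Induction on polynomials, derivations, and p-th powers in characteristic p *)

Lemma mpoly_ring_ind (n : nat) (R : comNzRingType) (A : {mpoly R[n]} -> Prop) :
  (forall c, A c%:MP) -> (forall i, A 'X_i) ->
  (forall F G, A F -> A G -> A (F + G)) ->
  (forall F G, A F -> A G -> A (F * G)) -> forall F, A F.
Proof.
move=> A_C A_X A_D A_M; elim/mpolyind => [|c m F _ _ AF]; first exact: (A_C 0).
apply: A_D => //; rewrite -mul_mpolyC; apply: (A_M) => //.
rewrite mpolyXE_id; apply: (big_ind A) => [|//|i _]; first exact: (A_C 1).
by elim: (m i) => [|k ih]; [exact: (A_C 1) | rewrite exprS; apply: A_M].
Qed.

Lemma eq_mpoly_rmorph (n : nat) (R S : comNzRingType)
    (f g : {rmorphism {mpoly R[n]} -> S}) :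
  (forall c, f c%:MP = g c%:MP) -> (forall i, f 'X_i = g 'X_i) -> f =1 g.
Proof.
move=> fgC fgX; elim/mpoly_ring_ind => // F G eF eG.
  by rewrite !rmorphD eF eG.
by rewrite !rmorphM eF eG.
Qed.

Section Derivation.
Variables (R : comNzRingType) (D : R -> R).
Hypothesis derD : derivation D.

Lemma derivation1 : D 1 = 0.
Proof.
case: derD => _ /(_ 1 1); rewrite !mulr1 mul1r => /eqP.
by rewrite -subr_eq subrr eq_sym => /eqP.
Qed.

Lemma derivation0 : D 0 = 0.
Proof.
case: derD => /(_ 0 0); rewrite !addr0 => /eqP.
by rewrite -subr_eq subrr eq_sym => /eqP.
Qed.

Lemma derivationN x : D (- x) = - D x.
Proof.
by case: derD => DA _; apply/eqP; rewrite -addr_eq0 -DA addNr derivation0.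
Qed.

Lemma derivation_sum I (r : seq I) (Q : pred I) (F : I -> R) :
  D (\sum_(i <- r | Q i) F i) = \sum_(i <- r | Q i) D (F i).
Proof. by case: derD => DA _; apply: big_morph => //; exact: derivation0. Qed.

Lemma derivationX x k : D (x ^+ k) = k%:R * x ^+ k.-1 * D x.
Proof.
case: derD => _ DM; elim: k => [|k ih]; first by rewrite derivation1 !mul0r.
rewrite exprS DM ih /=; case: k {ih} => [|k] /=; first by rewrite !expr0; ring.
by rewrite exprS -[k.+2]addn1 natrD; ring.
Qed.

Lemma derivation_prod_const I (r : seq I) (Q : pred I) (F : I -> R) :
  (forall i, Q i -> D (F i) = 0) -> D (\prod_(i <- r | Q i) F i) = 0.
Proof.
case: derD => _ DM DF; apply: (big_ind (fun x => D x = 0)) => //.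
  exact: derivation1.
by move=> x y ex ey; rewrite DM ex ey mul0r mulr0 addr0.
Qed.

Lemma derivation_sign k x : D ((-1) ^+ k * x) = (-1) ^+ k * D x.
Proof.
case: derD => _ DM; rewrite DM derivationX derivationN derivation1.
by rewrite oppr0 mulr0 mul0r add0r.
Qed.

Lemma derivation_det_const m (M : 'M[R]_m) :
  (forall i j, D (M i j) = 0) -> D (\det M) = 0.
Proof.
move=> DM0; rewrite /determinant derivation_sum big1 // => s _.
by rewrite derivation_sign derivation_prod_const ?mulr0.
Qed.

(** Expand along column [j0]: the cofactors involve only entries killed by [D], so [D] falls on that
    column alone. *)
Lemma derivation_det_col m (M : 'M[R]_m) (j0 : 'I_m) :
  (forall i j, j != j0 -> D (M i j) = 0) ->
  D (\det M) = \det (\matrix_(i, j) if j == j0 then D (M i j) else M i j).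
Proof.
case: derD => _ DM DM0; rewrite (expand_det_col _ j0) derivation_sum.
rewrite [RHS](expand_det_col _ j0); apply: eq_bigr => i _.
rewrite DM mxE eqxx /cofactor.
rewrite [X in _ + _ * X]derivation_sign derivation_det_const ?mulr0 ?addr0.
  congr (_ * (_ * \det _)); apply/matrixP => r s; rewrite !mxE.
  by rewrite eq_sym (negbTE (neq_lift _ _)).
by move=> r s; rewrite !mxE DM0 // eq_sym neq_lift.
Qed.

(** Chain rule for a polynomial whose coefficients are constants of [D]. *)
Lemma derivation_mmap n (A : comNzRingType) (f : {rmorphism A -> R})
    (h : 'I_n -> R) (G : {mpoly A[n]}) : (forall c, D (f c) = 0) ->
  D (mmap f h G) = \sum_(s < n) mmap f h G^`M(s) * D (h s).
Proof.
case: derD => DA DM Df; elim/mpoly_ring_ind: G => [c|i|F G eF eG|F G eF eG].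
- by rewrite mmapC Df big1 // => s _; rewrite mderivC mmap0 mul0r.
- rewrite mmapX mmap1U (bigD1 i) //= big1 => [|s /negbTE si].
    rewrite mderivX mnm1E eqxx scale1r (_ : (U_(i) - U_(i))%MM = 0%MM).
      by rewrite mmapX mmap11 mul1r addr0.
    by apply/mnmP=> t; rewrite mnmBE mnm0E subnn.
  by rewrite mderivX mnm1E eq_sym si scale0r mmap0 mul0r.
- rewrite rmorphD DA eF eG -big_split; apply: eq_bigr => s _ /=.
  by rewrite mderivD rmorphD mulrDl.
rewrite rmorphM DM eF eG mulr_suml mulr_sumr -big_split; apply: eq_bigr => s _ /=.
by rewrite mderivM rmorphD !rmorphM /=; ring.
Qed.

End Derivation.

(** Comparing coefficients in the derivatives shows that p divides every exponent in [F]. Frobenius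
    fixes the prime field, so a root is obtained by dividing all exponents by p and keeping the
    coefficients. *)
Lemma mderiv_pth_root (p n : nat) (F : {mpoly 'F_p[n]}) : prime p ->
  (forall i, F^`M(i) = 0) -> exists G : {mpoly 'F_p[n]}, F = G ^+ p.
Proof.
move=> p_prime F0.
have chP : p \in [pchar {mpoly 'F_p[n]}] by rewrite pchar_lalg pchar_Fp.
have dvd m i : m \in msupp F -> (p %| m i)%N.
  move=> mF; have [-> //|mi] := posnP (m i).
  have := mcoeff_mderiv i F (m - U_(i))%MM.
  rewrite F0 mcoeff0 mnmBE mnm1E eqxx subn1 prednK // submK; last first.
    by apply/mnm_lepP => j; rewrite mnm1E; case: eqP => [<-|].
  move/esym/eqP; rewrite -mulr_natr mulf_eq0 mcoeff_eq0 mF /=.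
  by rewrite -(dvdn_pcharf (pchar_Fp p_prime)).
exists (\sum_(m <- msupp F) F@_m *: 'X_[[multinom (m i %/ p)%N | i < n]]).
rewrite -(pFrobenius_autE chP) rmorph_sum [LHS]mpolyE /= !big_seq.
apply: eq_bigr => m mF; rewrite pFrobenius_autE exprZn mpolyXn.
have -> : F@_m ^+ p = F@_m by rewrite -[RHS]expf_card card_Fp.
congr (_ *: 'X_[_]); apply/mnmP => i.
by rewrite mulmnE mnmE divnK ?dvd.
Qed.

Lemma msize_exp_idomain (n : nat) (R : idomainType) (F : {mpoly R[n]}) k :
  F != 0 -> (msize (F ^+ k)).-1 = ((msize F).-1 * k)%N.
Proof.
move=> F0; elim: k => [|k ih]; first by rewrite expr0 msize1 muln0.
rewrite exprS msizeM ?expf_neq0 //.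
rewrite mulnS -ih (mpolySpred _ F0) (mpolySpred _ (expf_neq0 k F0)).
by rewrite addSn addnS.
Qed.

(** The derivation D_k of the overview; for [k = n] it is convertible to [St_poly]. *)
Definition power_der (p n k : nat) (F : {mpoly 'F_p[n]}) : {mpoly 'F_p[n]} :=
  \sum_(r < n) 'X_r ^+ (p ^ k) * F^`M(r).

Lemma power_der_derivation p n k : derivation (@power_der p n k).
Proof.
split=> F G; rewrite /power_der.
  by rewrite -big_split; apply: eq_bigr => r _; rewrite mderivD mulrDr.
rewrite mulr_suml mulr_sumr -big_split; apply: eq_bigr => r _ /=.
by rewrite mderivM; ring.
Qed.

Lemma power_derX p n k (r : 'I_n) :
  power_der k ('X_r : {mpoly 'F_p[n]}) = 'X_r ^+ (p ^ k).
Proof.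
rewrite /power_der (bigD1 r) //= big1 => [|s /negbTE sr].
  rewrite mderivX mnm1E eqxx scale1r (_ : (U_(r) - U_(r))%MM = 0%MM).
    by rewrite mpolyX0 mulr1 addr0.
  by apply/mnmP=> t; rewrite mnmBE mnm0E subnn.
by rewrite mderivX mnm1E eq_sym sr scale0r mulr0.
Qed.

Lemma power_derC p n k c : power_der k (c%:MP : {mpoly 'F_p[n]}) = 0.
Proof. by rewrite /power_der big1 // => r _; rewrite mderivC mulr0. Qed.

(** * Power derivations of Moore determinants *)

Section Bracket.
Variables (p : nat) (p_prime : prime p).

Lemma pchar_mpoly n : p \in [pchar {mpoly 'F_p[n]}].
Proof. by rewrite pchar_lalg pchar_Fp. Qed.

Lemma Fp_exp_p (c : 'F_p) : c ^+ p = c.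
Proof. by rewrite -[RHS]expf_card card_Fp. Qed.

Lemma Fp_exp_pX (c : 'F_p) e : c ^+ (p ^ e) = c.
Proof. by elim: e => // e ih; rewrite expnSr exprM ih Fp_exp_p. Qed.

Lemma power_derXX n k (r : 'I_n) e :
  power_der k ('X_r ^+ (p ^ e) : {mpoly 'F_p[n]}) =
  if e == 0%N then 'X_r ^+ (p ^ k) else 0.
Proof.
rewrite derivationX ?power_derX; last exact: power_der_derivation.
case: e => [|e] /=; first by rewrite expn0 !expr0 !mul1r.
suff -> : (p ^ e.+1)%:R = 0 :> {mpoly 'F_p[n]} by rewrite !mul0r.
by apply/eqP; rewrite -(dvdn_pcharf (pchar_mpoly n)) expnS dvdn_mulr.
Qed.

(** Columns with a positive exponent consist of p-th powers, which are constants; only column [j0]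
    is differentiated, and its entries x_r become x_r^(p^k). *)
Lemma power_der_bracket n k (e : 'I_n -> nat) (j0 : 'I_n) :
  e j0 = 0%N -> (forall j, j != j0 -> e j != 0%N) ->
  power_der k (@bracket p n e) = bracket p (fun j => if j == j0 then k else e j).
Proof.
move=> e0 e1; have der := @power_der_derivation p n k.
rewrite /bracket (derivation_det_col der (j0 := j0)) => [|i j jj0].
  congr (\det _); apply/matrixP => i j; rewrite !mxE.
  by case: eqP => // ->; rewrite power_derXX e0.
by rewrite mxE power_derXX (negbTE (e1 _ jj0)).
Qed.

Lemma power_der_bracket_eq0 n k (e : 'I_n -> nat) :
  (forall j, e j != 0%N) -> power_der k (@bracket p n e) = 0.
Proof.
move=> e0; apply: derivation_det_const => [|i j]; first exact: power_der_derivation.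
by rewrite mxE power_derXX (negbTE (e0 j)).
Qed.

Lemma eq_bracket n (e e' : 'I_n -> nat) : e =1 e' -> bracket p e = bracket p e'.
Proof. by move=> ee; congr (\det _); apply/matrixP => i j; rewrite !mxE ee. Qed.

Lemma bracket_repeat n (e : 'I_n -> nat) (i j : 'I_n) :
  i != j -> e i = e j -> bracket p e = 0.
Proof.
move=> ij eij; rewrite /bracket -det_tr.
by apply: (determinant_alternate ij) => r; rewrite !mxE eij.
Qed.

(** Laplace expansion along column 0 on the left and column [j] on the right produces the same
    minors, with signs differing by (-1)^j. *)
Lemma bracket_move_col m (e e' : 'I_m.+1 -> nat) (j : 'I_m.+1) :
  e ord0 = e' j -> (forall i, e (lift ord0 i) = e' (lift j i)) ->
  bracket p e = (-1) ^+ j * bracket p e'.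
Proof.
move=> e0 e1; rewrite /bracket (expand_det_col _ ord0) (expand_det_col _ j).
rewrite mulr_sumr; apply: eq_bigr => i _.
rewrite !mxE /cofactor addn0 exprD e0 [RHS]mulrCA; congr (_ * _).
rewrite [X in _ = _ * (X * _)]mulrC -mulrA signrMK.
congr (_ * \det _); apply/matrixP => r s; rewrite !mxE.
by rewrite e1.
Qed.

Lemma dickson_Ls_top n : dickson_Ls p n n = dickson_L p n.
Proof. by apply: eq_bracket => j; rewrite /bump leqNgt ltn_ord. Qed.

(** For s = 0 no column has exponent 0. Otherwise the first column gets exponent k. If k differs
    from s, this exponent is already present and the determinant vanishes; if k = s, moving the
    column past s - 1 others gives L_{n,0}. *)
Lemma power_der_Ls n k s : (0 < k <= n)%N -> (s <= n)%N ->
  power_der k (dickson_Ls p n s) =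
  if k == s then (-1) ^+ s.-1 * dickson_Ls p n 0 else 0.
Proof.
case: n => [|m]; first by case: k.
case/andP=> k0 kn; case: s => [|s] sn.
  by rewrite gtn_eqF // power_der_bracket_eq0.
rewrite (@power_der_bracket _ _ _ ord0) // => [|j].
  case: eqP => [ks|/eqP ks].
    have sm : (s < m.+1)%N by rewrite -ks.
    rewrite (@bracket_move_col _ _ (fun j => bump 0 j) (Ordinal sm)) //= => i.
    by rewrite /bump /=; lia.
  (* The column of exponent k has index k, or k - 1 when k lies beyond the omitted exponent. *)
  have jm : (k - (s.+1 < k) < m.+1)%N by lia.
  apply: (@bracket_repeat _ _ ord0 (Ordinal jm)).
    by rewrite -val_eqE /=; lia.
  rewrite eqxx -val_eqE /= /bump.
  by case: eqP => [|_]; lia.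
by rewrite -val_eqE /= /bump; case: (val j) => //; lia.
Qed.

End Bracket.

(** * The action of the general linear group and the first variable *)

(* [uni0] turns the first variable into the indeterminate of [{poly _}]. *)
Definition uni0 (R : comNzRingType) (n : nat) (F : {mpoly R[n.+1]}) :
    {poly {mpoly R[n]}} :=
  mmap (polyC \o @mpolyC n R)
    (fun i => if unlift ord0 i is Some j then ('X_j)%:P else 'X) F.

Section Uni0.
Variables (R : comNzRingType) (n : nat).

HB.instance Definition _ :=
  GRing.RMorphism.copy (@uni0 R n) (mmap (polyC \o @mpolyC n R) _).

Lemma uni0D : {morph @uni0 R n : F G / F + G}.
Proof. exact: rmorphD. Qed.

Lemma uni0M : {morph @uni0 R n : F G / F * G}.
Proof. exact: rmorphM. Qed.

Lemma uni0C c : uni0 (c%:MP : {mpoly R[n.+1]}) = (c%:MP)%:P.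
Proof. exact: mmapC. Qed.

Lemma uni0Z c (F : {mpoly R[n.+1]}) : uni0 (c *: F) = c%:MP *: uni0 F.
Proof. by rewrite -mul_mpolyC rmorphM /= uni0C mul_polyC. Qed.

Lemma uni0X0 : uni0 ('X_ord0 : {mpoly R[n.+1]}) = 'X.
Proof. by rewrite /uni0 mmapX mmap1U unlift_none. Qed.

Lemma uni0Xlift i : uni0 ('X_(lift ord0 i) : {mpoly R[n.+1]}) = ('X_i)%:P.
Proof. by rewrite /uni0 mmapX mmap1U liftK. Qed.

Let lift_tuple : n.-tuple {mpoly R[n.+1]} := [tuple 'X_(lift ord0 i) | i < n].

Let lift_poly (A : {poly {mpoly R[n]}}) : {mpoly R[n.+1]} :=
  (map_poly (comp_mpoly lift_tuple) A).['X_ord0].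

Lemma uni0_comp_lift (F : {mpoly R[n]}) : uni0 (F \mPo lift_tuple) = F%:P.
Proof.
apply: (eq_mpoly_rmorph (f := @uni0 R n \o comp_mpoly lift_tuple) (g := polyC)).
  by move=> c /=; rewrite comp_mpolyC uni0C.
by move=> i /=; rewrite comp_mpolyXU -tnth_nth tnth_mktuple uni0Xlift.
Qed.

Lemma uni0K : cancel (@uni0 R n) lift_poly.
Proof.
pose f := horner_eval ('X_ord0 : {mpoly R[n.+1]}) \o
  (map_poly (comp_mpoly lift_tuple)) \o @uni0 R n.
apply: (eq_mpoly_rmorph (f := f) (g := idfun)) => [c|i] /=.
  by rewrite /f /= uni0C map_polyC /= /horner_eval hornerC comp_mpolyC.
rewrite /f /= /horner_eval; case: (unliftP ord0 i) => [j ->|->].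
  by rewrite uni0Xlift map_polyC /= hornerC comp_mpolyXU -tnth_nth tnth_mktuple.
by rewrite uni0X0 map_polyX hornerX.
Qed.

Lemma uni0_inj : injective (@uni0 R n).
Proof. exact: can_inj uni0K. Qed.

Lemma uni0_surj (A : {poly {mpoly R[n]}}) : exists F, A = uni0 F.
Proof.
exists (lift_poly A); elim/poly_ind: A => [|A c eA].
  by rewrite /lift_poly map_poly0 horner0 rmorph0.
rewrite /lift_poly rmorphD rmorphM /= map_polyX map_polyC hornerD hornerM.
by rewrite hornerX hornerC rmorphD rmorphM /= -eA uni0X0 uni0_comp_lift.
Qed.

End Uni0.

Definition linform (p n : nat) (v : 'rV['F_p]_n) : {mpoly 'F_p[n]} :=
  \sum_(j < n) v 0 j *: 'X_j.

(** The substitution of [GL_invariant], kept convertible to it. *)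
Definition gl_tuple (p n : nat) (g : 'M['F_p]_n) : n.-tuple {mpoly 'F_p[n]} :=
  [tuple \sum_(j < n) g i j *: 'X_j | i < n].

Section Action.
Variables (p : nat) (p_prime : prime p).

Lemma comp_gl_tupleX n (g : 'M['F_p]_n) i :
  'X_i \mPo gl_tuple g = \sum_(j < n) g i j *: 'X_j.
Proof. by rewrite comp_mpolyXU -tnth_nth tnth_mktuple. Qed.

Lemma comp_gl_tuple1 n (F : {mpoly 'F_p[n]}) : F \mPo gl_tuple 1%:M = F.
Proof.
apply: (eq_mpoly_rmorph (f := comp_mpoly (gl_tuple 1%:M)) (g := idfun)) => [c|i] /=.
  exact: comp_mpolyC.
rewrite comp_gl_tupleX (bigD1 i) //= mxE eqxx scale1r big1 ?addr0 //.
by move=> k /negbTE ki; rewrite mxE eq_sym ki scale0r.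
Qed.

(** Powers with exponent p^e are additive and fix the prime field, so the substituted Moore matrix
    is [g] times the original one. *)
Lemma bracket_gl n (g : 'M['F_p]_n) (e : 'I_n -> nat) :
  bracket p e \mPo gl_tuple g = (\det g)%:MP * bracket p e.
Proof.
rewrite /bracket -[LHS]det_map_mx -[X in X * _]det_map_mx -det_mulmx.
congr (\det _); apply/matrixP => i j; rewrite !mxE rmorphXn /= comp_gl_tupleX.
have chP : [pchar {mpoly 'F_p[n]}].-nat (p ^ e j)%N.
  by rewrite pnatX (pnatE _ p_prime) pchar_mpoly.
elim: (index_enum _) => [|k r ih].
  by rewrite !big_nil expr0n expn_eq0 eqn0Ngt prime_gt0.
rewrite !big_cons exprDn_pchar // ih !mxE exprZn Fp_exp_pX //.
by rewrite mul_mpolyC.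
Qed.

Lemma uni0_gl_X n (g : 'M['F_p]_n.+1) i :
  uni0 ('X_i \mPo gl_tuple g) =
  (g i ord0)%:MP *: 'X + (linform (\row_j g i (lift ord0 j)))%:P.
Proof.
rewrite comp_gl_tupleX big_ord_recl rmorphD /= uni0Z uni0X0; congr (_ + _).
rewrite /linform !rmorph_sum; apply: eq_bigr => j _ /=.
by rewrite uni0Z uni0Xlift mxE -mul_mpolyC polyCM mul_polyC.
Qed.

(** Row i describes the image of variable i: the first variable x goes to a x + v, and the others
    are transformed by [h] and then receive multiples of x given by [w]. *)
Definition gl_block n (a : 'F_p) (v : 'rV_n) (w : 'cV_n) (h : 'M_n) :
  'M['F_p]_n.+1 := block_mx a%:M v w h.

Section BlockEntries.
Variables (n : nat) (a : 'F_p) (v : 'rV['F_p]_n) (w : 'cV['F_p]_n) (h : 'M['F_p]_n).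

Lemma gl_block0 : gl_block a v w h ord0 ord0 = a.
Proof.
transitivity (block_mx a%:M v w h (lshift n ord0) (lshift n ord0)).
  by congr (fun_of_matrix _ _ _); apply: val_inj.
by rewrite block_mxEul mxE eqxx.
Qed.

Lemma gl_block0lift j : gl_block a v w h ord0 (lift ord0 j) = v 0 j.
Proof.
transitivity (block_mx a%:M v w h (lshift n ord0) (rshift 1 j)).
  by congr (fun_of_matrix _ _ _); apply: val_inj.
by rewrite block_mxEur.
Qed.

Lemma gl_blocklift0 i : gl_block a v w h (lift ord0 i) ord0 = w i 0.
Proof.
transitivity (block_mx a%:M v w h (rshift 1 i) (lshift n ord0)).
  by congr (fun_of_matrix _ _ _); apply: val_inj.
by rewrite block_mxEdl.
Qed.

Lemma gl_blocklift i j : gl_block a v w h (lift ord0 i) (lift ord0 j) = h i j.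
Proof.
transitivity (block_mx a%:M v w h (rshift 1 i) (rshift 1 j)).
  by congr (fun_of_matrix _ _ _); apply: val_inj.
by rewrite block_mxEdr.
Qed.

End BlockEntries.

(** When [w = 0] the other variables mix only among themselves: [h] acts on the coefficients, and
    the indeterminate undergoes an affine change. *)
Lemma uni0_gl_block n (F : {mpoly 'F_p[n.+1]}) (a : 'F_p) (v : 'rV_n) (h : 'M_n) :
  uni0 (F \mPo gl_tuple (gl_block a v 0 h)) =
  map_poly (comp_mpoly (gl_tuple h)) (uni0 F) \Po (a%:MP *: 'X + (linform v)%:P).
Proof.
pose f := @uni0 'F_p n \o comp_mpoly (gl_tuple (gl_block a v 0 h)).
pose g := comp_poly (a%:MP *: 'X + (linform v)%:P) \o
  map_poly (comp_mpoly (gl_tuple h)) \o @uni0 'F_p n.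
apply: (eq_mpoly_rmorph (f := f) (g := g)) => [c|i].
  by rewrite /f /g /= comp_mpolyC uni0C map_polyC /= comp_mpolyC comp_polyC.
rewrite /f /g /= uni0_gl_X; case: (unliftP ord0 i) => [j ->|->].
  rewrite uni0Xlift map_polyC comp_polyC /= gl_blocklift0 mxE mpolyC0 scale0r add0r.
  rewrite comp_gl_tupleX; congr (_%:P); apply: eq_bigr => k _.
  by rewrite mxE gl_blocklift.
rewrite uni0X0 map_polyX comp_polyX gl_block0; congr (_ + (linform _)%:P).
by apply/rowP => k; rewrite mxE gl_block0lift.
Qed.

Lemma coef01_polyC (R : comNzRingType) (c : R) :
  (c%:P)`_0 = c /\ (c%:P)`_1 = 0.
Proof. by rewrite !coefC. Qed.

Lemma coef01_linear (R : comNzRingType) (c d : R) :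
  (c *: 'X + d%:P)`_0 = d /\ (c *: 'X + d%:P)`_1 = c.
Proof. by rewrite !coefD !coefZ !coefX !coefC mulr0 mulr1 addr0 add0r. Qed.

Lemma coef01M (R : comNzRingType) (A B : {poly R}) :
  (A * B)`_0 = A`_0 * B`_0 /\ (A * B)`_1 = A`_0 * B`_1 + A`_1 * B`_0.
Proof. by rewrite !coefM !big_ord_recl !big_ord0 /= !addr0. Qed.

Lemma coef01D (R : comNzRingType) (A B : {poly R}) :
  (A + B)`_0 = A`_0 + B`_0 /\ (A + B)`_1 = A`_1 + B`_1.
Proof. by rewrite !coefD. Qed.

(** Modulo T^2, [A] is [B] plus T times the derivative of the constant term of [B] in the direction
    [w]. As a relation compatible with sums and products, it need only be checked on constants and
    variables. *)
Definition first_order n (w : 'cV['F_p]_n) (A B : {poly {mpoly 'F_p[n]}}) :=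
  A`_0 = B`_0 /\ A`_1 = B`_1 + \sum_(j < n) w j 0 *: B`_0^`M(j).

Lemma first_orderD n (w : 'cV['F_p]_n) A A' B B' : first_order w A A' ->
  first_order w B B' -> first_order w (A + B) (A' + B').
Proof.
move=> [A0 A1] [B0 B1]; rewrite /first_order.
have [-> ->] := coef01D A B; have [-> ->] := coef01D A' B'.
rewrite A0 A1 B0 B1; split; first by [].
rewrite addrACA -big_split /=; congr (_ + _).
by apply: eq_bigr => j _; rewrite mderivD scalerDr.
Qed.

Lemma first_orderM n (w : 'cV['F_p]_n) A A' B B' : first_order w A A' ->
  first_order w B B' -> first_order w (A * B) (A' * B').
Proof.
move=> [A0 A1] [B0 B1]; rewrite /first_order.
have [-> ->] := coef01M A B; have [-> ->] := coef01M A' B'.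
rewrite A0 A1 B0 B1; split; first by [].
rewrite mulrDl mulrDr addrACA; congr (_ + _).
rewrite mulr_suml mulr_sumr -big_split; apply: eq_bigr => j _ /=.
by rewrite mderivM scalerDr -scalerAr -scalerAl addrC.
Qed.

Lemma uni0_gl_shift n (F : {mpoly 'F_p[n.+1]}) (v : 'rV_n) :
  uni0 (F \mPo gl_tuple (gl_block 1 v 0 1%:M)) = uni0 F \Po ('X + (linform v)%:P).
Proof.
rewrite uni0_gl_block scale1r; congr (_ \Po _).
by rewrite (eq_map_poly (@comp_gl_tuple1 n)) map_poly_id.
Qed.

Lemma det_gl_block n (a : 'F_p) (v : 'rV_n) (h : 'M_n) :
  \det (gl_block a v 0 h) = a * \det h.
Proof. by have := det_ublock (a%:M : 'M_1) v h; rewrite det_scalar1. Qed.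

(* The Taylor expansion of [F (x_1 + w_1 T, ..., x_n + w_n T)] modulo [T^2]. *)
Lemma uni0_gl_column n (F : {mpoly 'F_p[n.+1]}) (w : 'cV_n) :
  first_order w (uni0 (F \mPo gl_tuple (gl_block 1 0 w 1%:M)))
    (uni0 F).
Proof.
set t := gl_tuple _; elim/mpoly_ring_ind: F => [c|i|F G|F G].
- rewrite comp_mpolyC uni0C /first_order; have [-> ->] := coef01_polyC c%:MP_[n].
  split; first by [].
  by rewrite big1 ?addr0 // => j _; rewrite mderivC scaler0.
- rewrite uni0_gl_X /first_order.
  set c := _%:MP; set d := linform _; have [-> ->] := coef01_linear c d.
  rewrite /c /d => {c d}.
  case: (unliftP ord0 i) => [j ->|->].
    rewrite uni0Xlift; have [-> ->] := coef01_polyC ('X_j : {mpoly 'F_p[n]}).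
    rewrite gl_blocklift0 add0r; split.
      rewrite /linform (bigD1 j) //= mxE gl_blocklift mxE eqxx scale1r big1 ?addr0 //.
      by move=> k /negbTE kj; rewrite mxE gl_blocklift mxE eq_sym kj scale0r.
    rewrite (bigD1 j) //= mderivX mnm1E eqxx scale1r.
    rewrite (_ : (U_(j) - U_(j))%MM = 0%MM) ?mpolyX0; last first.
      by apply/mnmP=> t'; rewrite mnmBE mnm0E subnn.
    rewrite big1 ?addr0 => [|k /negbTE kj]; first by rewrite alg_mpolyC.
    by rewrite mderivX mnm1E eq_sym kj scale0r scaler0.
  rewrite uni0X0 gl_block0 !coefX /= /linform !big1 ?addr0 // => k _.
    by rewrite mderiv0 scaler0.
  by rewrite mxE gl_block0lift mxE scale0r.
- by move=> eF eG; rewrite comp_mpolyD 2!uni0D; apply: first_orderD.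
move=> eF eG; rewrite (_ : F * G \mPo t = (F \mPo t) * (G \mPo t)); last exact: rmorphM.
by rewrite 2!uni0M; exact: first_orderM.
Qed.

End Action.

(** * The Dickson invariants as coefficients *)

Definition form_prod (p n : nat) : {poly {mpoly 'F_p[n]}} :=
  \prod_(v : 'rV['F_p]_n) ('X - (linform v)%:P).

(* Up to sign, [L_{n,s} / L_n] is the coefficient of [T ^+ (p ^ s)] in the
   product of all [T - v], [v] a linear form: see [dickson_qL]. *)
Definition dickson_q (p n s : nat) : {mpoly 'F_p[n]} :=
  (-1) ^+ (n + s) * (form_prod p n)`_(p ^ s).

Section FormProd.
Variables (p : nat) (p_prime : prime p).

Lemma mcoeff_linform n (v : 'rV['F_p]_n) j : (linform v)@_U_(j) = v 0 j.
Proof.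
rewrite /linform raddf_sum (bigD1 j) //= mcoeffZ mcoeffXU eqxx mulr1.
by rewrite big1 ?addr0 // => k /negbTE kj; rewrite mcoeffZ mcoeffXU kj mulr0.
Qed.

Lemma linform_inj n : injective (@linform p n).
Proof.
by move=> u v uv; apply/rowP => j; rewrite -!mcoeff_linform uv.
Qed.

Lemma linformD n (u v : 'rV['F_p]_n) : linform (u + v) = linform u + linform v.
Proof.
rewrite /linform -big_split; apply: eq_bigr => j _ /=.
by rewrite mxE scalerDl.
Qed.

Lemma linform0 n : linform (0 : 'rV['F_p]_n) = 0.
Proof. by rewrite /linform big1 // => j _; rewrite mxE scale0r. Qed.

Lemma card_rV_Fp n : #|{: 'rV['F_p]_n}| = (p ^ n)%N.
Proof. by rewrite card_mx card_Fp // mul1n. Qed.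

Lemma form_prod_monic n : form_prod p n \is monic.
Proof. exact: monic_prod_XsubC. Qed.

Lemma size_form_prod n : size (form_prod p n) = (p ^ n).+1.
Proof.
by rewrite /form_prod (size_prod_XsubC _ (@linform p n)) -card_rV_Fp cardT enumT.
Qed.

Lemma form_prod_root n (v : 'rV['F_p]_n) : (form_prod p n).[linform v] = 0.
Proof.
rewrite /form_prod (bigD1 v) //.
by rewrite hornerM hornerXsubC subrr mul0r.
Qed.

(** The p^n linear forms are distinct, hence too many roots for a nonzero polynomial of this
    size. *)
Lemma poly_forms_eq0 n (A : {poly {mpoly 'F_p[n]}}) : (size A <= p ^ n)%N ->
  (forall v, A.[linform v] = 0) -> A = 0.
Proof.
move=> sA rA; apply: contraTeq sA => A0; rewrite -ltnNge -card_rV_Fp cardE.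
rewrite -(size_map (@linform p n)); apply: max_poly_roots => //.
  by apply/allP => _ /mapP[v _ ->]; rewrite /root rA.
by rewrite map_inj_uniq ?enum_uniq //; exact: linform_inj.
Qed.

(** The remainder modulo the monic [form_prod] still vanishes at every linear form and has degree
    below p^n. *)
Lemma form_prod_dvd n (A : {poly {mpoly 'F_p[n]}}) :
  (forall v, A.[linform v] = 0) -> exists B, A = B * form_prod p n.
Proof.
move=> rA; have fm := form_prod_monic n.
have eA := Pdiv.RingMonic.rdivp_eq fm A.
exists (Pdiv.CommonRing.rdivp A (form_prod p n)).
rewrite {1}eA [X in _ + X]poly_forms_eq0 ?addr0 //.
  by rewrite -ltnS -size_form_prod Pdiv.CommonRing.ltn_rmodp monic_neq0.
move=> v; have := rA v; rewrite {1}eA hornerD hornerM form_prod_root.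
by rewrite mulr0 add0r.
Qed.

Lemma form_prod_shift n (u : 'rV['F_p]_n) :
  form_prod p n \Po ('X + (linform u)%:P) = form_prod p n.
Proof.
rewrite /form_prod rmorph_prod (reindex (fun v => v + u)) /=; last first.
  by exists (fun v => v - u) => v _; rewrite ?addrK ?subrK.
apply: eq_bigr => v _.
by rewrite rmorphB /= comp_polyX comp_polyC linformD polyCD opprD addrACA subrr addr0.
Qed.

Lemma uni0_L n : uni0 (dickson_L p n.+1) =
  \sum_(s < n.+1) ((-1) ^+ s * dickson_Ls p n s) *: 'X^(p ^ s).
Proof.
rewrite /dickson_L /bracket -det_map_mx (expand_det_row _ ord0).
apply: eq_bigr => s _; rewrite !mxE rmorphXn /= uni0X0 mulrC -mul_polyC.
congr (_ * _); rewrite /cofactor polyCM add0n rmorphXn rmorphN1; congr (_ * _).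
rewrite /dickson_Ls /bracket -[RHS]det_map_mx; congr (\det _).
by apply/matrixP => i j; rewrite !mxE !rmorphXn /= uni0Xlift.
Qed.

Lemma coef_uni0_L n s : (s <= n)%N ->
  (uni0 (dickson_L p n.+1))`_(p ^ s) = (-1) ^+ s * dickson_Ls p n s.
Proof.
rewrite -ltnS => sn; rewrite uni0_L coef_sum (bigD1 (Ordinal sn)) //=.
rewrite coefZ coefXn eqxx mulr1 big1 ?addr0 // => i; rewrite -val_eqE /= => is_.
by rewrite coefZ coefXn eqn_exp2l ?prime_gt1 // eq_sym (negbTE is_) mulr0.
Qed.

Lemma size_uni0_L n : (size (uni0 (dickson_L p n.+1)) <= (p ^ n).+1)%N.
Proof.
rewrite uni0_L; apply: (leq_trans (size_sum _ _ _)); apply/bigmax_leqP => s _.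
rewrite (leq_trans (size_scale_leq _ _)) // size_polyXn ltnS.
by rewrite leq_exp2l ?prime_gt1 // -ltnS.
Qed.

(** Both sides have the same coefficient at T^(p^n) and no higher terms, and both vanish at all
    linear forms; their difference therefore has too many roots. *)
Lemma uni0_L_form_prod n :
  uni0 (dickson_L p n.+1) = ((-1) ^+ n * dickson_L p n) *: form_prod p n.
Proof.
apply/eqP; rewrite -subr_eq0; apply/eqP; apply: poly_forms_eq0.
  apply/leq_sizeP => j; rewrite leq_eqVlt coefB coefZ => /predU1P[<-|nj].
    rewrite coef_uni0_L // dickson_Ls_top.
    have /eqP := form_prod_monic n; rewrite /lead_coef size_form_prod => ->.
    by rewrite mulr1 subrr.
  rewrite !nth_default ?mulr0 ?subrr ?size_form_prod //.
  exact: leq_trans (size_uni0_L n) nj.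
move=> v; rewrite hornerD hornerN hornerZ form_prod_root mulr0 subr0.
(* The shift by [v] has determinant one and fixes the determinant, so the value at [v] equals the
   value at 0, where every T^(p^s) vanishes. *)
have := uni0_gl_shift (dickson_L p n.+1) v.
rewrite bracket_gl // det_gl_block det1 mulr1 mpolyC1 mul1r.
move/(congr1 (fun A : {poly {mpoly 'F_p[n]}} => A.[0])).
rewrite horner_comp !hornerE => <-; rewrite uni0_L horner_sum big1 // => s _.
by rewrite hornerZ hornerXn expr0n expn_eq0 eqn0Ngt prime_gt0 ?mulr0.
Qed.

(** Up to sign, L_n is the coefficient of T^(p^n) in L_{n+1}. *)
Lemma dickson_L_neq0 n : dickson_L p n != 0.
Proof.
elim: n => [|n ih]; first by rewrite /dickson_L /bracket det_mx00 oner_neq0.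
apply: contraNneq ih => L0; have := coef_uni0_L (leqnn n).
rewrite L0 rmorph0 coef0 dickson_Ls_top => /esym/eqP.
by rewrite mulf_eq0 signr_eq0.
Qed.

(** Compare the coefficients of T^(p^s) in the row expansion of L_{n+1} and in its factorization
    through [form_prod]. *)
Lemma dickson_qL n s : (s <= n)%N ->
  dickson_q p n s * dickson_L p n = dickson_Ls p n s.
Proof.
move=> sn; have := coef_uni0_L sn; rewrite uni0_L_form_prod coefZ => e.
rewrite -[RHS](signrMK s) -e /dickson_q exprD; ring.
Qed.

End FormProd.

(** * Invariance of the Dickson polynomials and their restriction to a hyperplane *)

Lemma coef_exp_pchar (R : comNzRingType) (p : nat) (A : {poly R}) k :
  p \in [pchar R] -> (A ^+ p)`_(k * p) = A`_k ^+ p.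
Proof.
move=> chR; have p0 : (0 < p)%N by rewrite prime_gt0 ?(pcharf_prime chR).
have chA : p \in [pchar {poly R}] by rewrite pchar_poly.
have e0 : 0 ^+ p = 0 :> R by rewrite expr0n eqn0Ngt p0.
elim/poly_ind: A k => [|A c ih] k.
  by rewrite expr0n eqn0Ngt p0 /= !coef0 e0.
rewrite -(pFrobenius_autE chA) rmorphD rmorphM /= !pFrobenius_autE.
rewrite -polyC_exp coefD coefC coefD coefMX coefC coefMXn.
case: k => [|k]; first by rewrite mul0n p0 eqxx !add0r.
rewrite mulSn addnC ltnNge leq_addl /= addnK ih addn_eq0 addr0.
by rewrite (gtn_eqF p0) andbF addr0.
Qed.

Section Dickson.
Variables (p : nat) (p_prime : prime p) (p_odd : odd p).

(** Frobenius applied entrywise raises every exponent of the Moore matrix by one. *)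
Lemma dickson_L0 n : dickson_Ls p n 0 = dickson_L p n ^+ p.
Proof.
have chP := pchar_mpoly p_prime n.
rewrite -(pFrobenius_autE chP) /dickson_L /bracket -det_map_mx.
congr (\det _); apply/matrixP => i j; rewrite !mxE.
transitivity (('X_i ^+ (p ^ j)) ^+ p : {mpoly 'F_p[n]}); last first.
  exact: esym (pFrobenius_autE chP _).
by rewrite -exprM -expnSr.
Qed.

Lemma dickson_q0 n : dickson_q p n 0 = dickson_L p n ^+ p.-1.
Proof.
apply: (mulIf (dickson_L_neq0 p_prime n)).
by rewrite dickson_qL // dickson_L0 -exprSr prednK // prime_gt0.
Qed.

Lemma dickson_q0_neq0 n : dickson_q p n 0 != 0.
Proof. by rewrite dickson_q0; apply: expf_neq0; exact: dickson_L_neq0. Qed.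

(** Both L_{n,s} and L_n are multiplied by det g, which cancels in the quotient. *)
Lemma dickson_q_invariant n s : (s <= n)%N -> GL_invariant (dickson_q p n s).
Proof.
move=> sn g; rewrite unitmxE unitfE => g0.
have gP0 : (\det g)%:MP_[n] * dickson_L p n != 0.
  by rewrite mulf_neq0 ?dickson_L_neq0 // mpolyC_eq0.
apply: (mulIf gP0); rewrite [RHS]mulrCA dickson_qL //.
have eL := bracket_gl p_prime g (fun j : 'I_n => j).
have eLs := bracket_gl p_prime g (fun j : 'I_n => bump s j).
rewrite -[X in _ * X]eL -[RHS]eLs.
have := dickson_qL p_prime sn; rewrite /dickson_L /dickson_Ls => <-.
by apply/esym; exact: (rmorphM (comp_mpoly (gl_tuple g))).
Qed.

Lemma uni0_linform n (v : 'rV['F_p]_n.+1) :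
  (uni0 (linform v))`_0 = linform (\row_j v 0 (lift ord0 j)).
Proof.
rewrite /linform big_ord_recl uni0D uni0Z uni0X0 coefD coefZ coefX mulr0 add0r.
rewrite rmorph_sum coef_sum; apply: eq_bigr => j _ /=.
by rewrite uni0Z uni0Xlift coefZ coefC eqxx mxE mul_mpolyC.
Qed.

(** Linear forms that differ only in the first coefficient become equal when the first variable is
    zero, so each factor occurs p times. *)
Lemma form_prod_restrict n :
  map_poly (horner_eval 0 \o @uni0 'F_p n) (form_prod p n.+1) = form_prod p n ^+ p.
Proof.
pose c (x : 'F_p * 'rV['F_p]_n) : 'rV['F_p]_n.+1 :=
  \row_j (if unlift ord0 j is Some k then x.2 0 k else x.1).
rewrite /form_prod rmorph_prod (reindex c); last first.
  exists (fun v : 'rV['F_p]_n.+1 => (v 0 ord0, \row_j v 0 (lift ord0 j))) => [[a u] _|v _].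
    rewrite mxE unlift_none; congr pair.
    by apply/rowP => j; rewrite !mxE liftK.
  apply/rowP => j; rewrite !mxE.
  by case: (unliftP ord0 j) => [k ->|->] //; rewrite mxE.
transitivity (\prod_(a : 'F_p) \prod_(u : 'rV['F_p]_n) ('X - (linform u)%:P)).
  rewrite pair_bigA; apply: eq_bigr => -[a u] _.
  rewrite rmorphB /= map_polyX map_polyC /= /horner_eval.
  rewrite horner_coef0 uni0_linform; congr (_ - (linform _)%:P).
  by apply/rowP => j; rewrite !mxE liftK.
by rewrite prodr_const card_Fp.
Qed.

Lemma Fp_signX (b : nat) n : ((-1) ^+ b : {mpoly 'F_p[n]}) ^+ p = (-1) ^+ b.
Proof. by rewrite exprAC -(signr_odd _ p) p_odd expr1. Qed.

Lemma dickson_q_restrict n s :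
  (uni0 (dickson_q p n.+1 s.+1))`_0 = dickson_q p n s ^+ p.
Proof.
rewrite /dickson_q exprMn Fp_signX -horner_coef0.
rewrite -/(horner_eval 0 _) rmorphM rmorphM /= rmorphXn rmorphN1 rmorphXn rmorphN1.
rewrite addSn addnS exprS exprS mulN1r mulN1r opprK; congr (_ * _).
have := congr1 (fun A : {poly {mpoly 'F_p[n]}} => A`_(p ^ s.+1)) (form_prod_restrict n).
rewrite coef_map /= => ->; rewrite expnSr coef_exp_pchar //.
exact: pchar_mpoly.
Qed.

End Dickson.

(** * Invariants vanishing on a hyperplane *)

Lemma coef_comp_scaleX (R : comNzRingType) (A : {poly R}) (c : R) k :
  (A \Po (c *: 'X))`_k = c ^+ k * A`_k.
Proof.
rewrite comp_polyE coef_sum; have [kA|kA] := ltnP k (size A); last first.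
  rewrite [A`_k]nth_default // mulr0 big1 // => i _.
  by rewrite exprZn !coefZ coefXn gtn_eqF ?mulr0 // (leq_trans (ltn_ord i)).
rewrite (bigD1 (Ordinal kA)) //= exprZn !coefZ coefXn eqxx mulr1 mulrC big1 ?addr0 //.
move=> i; rewrite -val_eqE /= eq_sym => /negbTE ik.
by rewrite exprZn !coefZ coefXn ik !mulr0.
Qed.

Lemma poly_root0 (R : comNzRingType) (A : {poly R}) :
  A`_0 = 0 -> exists B, A = B * 'X.
Proof.
move=> A0; have /factor_theorem[B] : root A 0 by rewrite /root horner_coef0 A0.
by rewrite polyC0 subr0; exists B.
Qed.

(** The coefficient in question is G(0) h(0)^k. *)
Lemma horner0_mulXn_eq0 (R : idomainType) (G h : {poly R}) k :
  (G * (h * 'X) ^+ k)`_k = 0 -> h.[0] != 0 -> G.[0] = 0.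
Proof.
rewrite exprMn mulrA coefMXn ltnn subnn -horner_coef0 hornerM horner_exp.
by move=> /eqP; rewrite mulf_eq0 expf_eq0 => /orP[/eqP|/andP[_ ->]].
Qed.

Lemma monic_dvd_scale (R : idomainType) (c : R) (A B m : {poly R}) :
  m \is monic -> c != 0 -> c *: A = B * m -> exists C, A = C * m.
Proof.
move=> mm c0 e; apply/(Pdiv.RingMonic.rdvdpP mm).
have : c *: Pdiv.CommonRing.rmodp A m == 0.
  by rewrite -Pdiv.RingMonic.rmodpZ // e Pdiv.RingMonic.rmodp_mull.
by rewrite scale_poly_eq0 (negbTE c0).
Qed.

Lemma coef_dvd_scale (R : comNzRingType) (c : R) (A : {poly R}) :
  (forall k, exists a, A`_k = a * c) -> exists B, A = c *: B.
Proof.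
move=> Ac; have [f Af] := fin_all_exists (fun k : 'I_(size A) => Ac k).
exists (\poly_(k < size A) (if insub k is Some i then f i else 0)).
apply/polyP => k; rewrite coefZ coef_poly.
case: ltnP => kA; last by rewrite mulr0 nth_default.
by rewrite insubT (Af (Ordinal kA)) mulrC.
Qed.

Lemma expf_pchar_inj (R : idomainType) p : p \in [pchar R] ->
  injective (fun x : R => x ^+ p).
Proof.
move=> chR x y /eqP; rewrite -subr_eq0 -!(pFrobenius_autE chR) -rmorphB /=.
by rewrite pFrobenius_autE expf_eq0 subr_eq0 => /andP[_ /eqP].
Qed.

Lemma odd_pred p : odd p -> odd p.-1 = false.
Proof. by case: p => // p /negbTE. Qed.

Lemma sign_exp_even (R : nzRingType) n k : odd k = false ->
  ((-1) ^+ n : R) ^+ k = 1.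
Proof. by move=> k_even; rewrite exprAC -(signr_odd _ k) k_even expr1n. Qed.

Section Divisibility.
Variables (p : nat) (p_prime : prime p) (p_odd : odd p).

(** Otherwise all p - 1 nonzero elements would be roots of X^k - 1, with k < p - 1. *)
Lemma Fp_exp_neq1 k : (0 < k < p.-1)%N -> exists2 a : 'F_p, a != 0 & a ^+ k != 1.
Proof.
case/andP=> k0 kp; apply/exists_inP; apply: contraLR kp => /exists_inPn kP.
rewrite -leqNgt -[p in p.-1](card_Fp p_prime) -(cardC1 (0 : 'F_p)) cardE.
apply: max_unity_roots => //; last exact: enum_uniq.
apply/allP => a; rewrite mem_enum => a0; apply/unity_rootP.
by apply/eqP; move: (kP a a0); rewrite negbK.
Qed.

(** Zero is a simple root: the cofactor takes the value Q_{n,0} at 0, up to sign. *)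
Lemma form_prod_factor n :
  exists2 h, form_prod p n = h * 'X & h.[0] != 0.
Proof.
have [|h fh] := @poly_root0 _ (form_prod p n).
  by have := form_prod_root (0 : 'rV['F_p]_n); rewrite linform0 horner_coef0.
exists h => [//|]; have := dickson_q0_neq0 p_prime n.
rewrite /dickson_q expn0 fh coefMX /= -horner_coef0.
by rewrite mulf_eq0 signr_eq0.
Qed.

(** Write f for [form_prod] and extract its factors one at a time from A = G f^k, k < p - 1. Scaling
    by some a with a^k different from 1 kills the coefficient of T^k (for k = 0 it vanishes by
    hypothesis), whence G(0) = 0. Since f is shift invariant, so is G; it then vanishes at all
    linear forms and is divisible by f. *)
Lemma form_prod_exp_dvd n (A : {poly {mpoly 'F_p[n]}}) :
  (forall v, A \Po ('X + (linform v)%:P) = A) ->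
  (forall a : 'F_p, a != 0 -> A \Po (a%:MP *: 'X) = A) -> A`_0 = 0 ->
  exists B, A = B * form_prod p n ^+ p.-1.
Proof.
move=> shiftA scaleA A0; have [h fh h0] := form_prod_factor n.
have f0 := monic_neq0 (form_prod_monic p n).
suff H k : (k <= p.-1)%N -> exists B, A = B * form_prod p n ^+ k by exact: H.
elim: k => [_|k ih kp]; first by exists A; rewrite expr0 mulr1.
have [G AG] := ih (ltnW kp).
have Ak : A`_k = 0.
  have [-> //|k0] := posnP k.
  have /Fp_exp_neq1[a a0 ak] : (0 < k < p.-1)%N by rewrite k0.
  have := coef_comp_scaleX A a%:MP k; rewrite scaleA // => /eqP.
  rewrite -subr_eq0 -[X in X - _]mul1r -mulrBl mulf_eq0 => /orP[|/eqP //].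
  by rewrite subr_eq0 eq_sym -rmorphXn /= -mpolyC1 mpolyC_eq (negbTE ak).
have G0 : G.[0] = 0 by apply: (horner0_mulXn_eq0 (k := k) _ h0); rewrite -fh -AG.
have [v|B GB] := @form_prod_dvd _ p_prime _ G.
  have : G \Po ('X + (linform v)%:P) = G.
    apply: (mulIf (expf_neq0 k f0)); rewrite -AG -[RHS](shiftA v) AG.
    by rewrite rmorphM rmorphXn /= form_prod_shift.
  move=> /(congr1 (fun A : {poly {mpoly 'F_p[n]}} => A.[0])).
  by rewrite horner_comp hornerD hornerX hornerC add0r G0.
by exists B; rewrite exprS mulrA -GB.
Qed.

Lemma coef_uni0_invariant n (F : {mpoly 'F_p[n.+1]}) k :
  GL_invariant F -> GL_invariant (uni0 F)`_k.
Proof.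
move=> invF h hU; rewrite -/(gl_tuple h).
have gU : gl_block 1 0 0 h \in unitmx by rewrite unitmxE det_gl_block mul1r -unitmxE.
rewrite -{2}(invF _ gU) -/(gl_tuple _) uni0_gl_block linform0 addr0 scale1r.
by rewrite comp_polyXr coef_map.
Qed.

(** Induction on n. The coefficients of [F] in the first variable are invariants divisible by every
    remaining variable, hence by L_n^(p-1). Also f^(p-1) divides [F], where f is [form_prod]. As f
    is monic, the divisibilities combine to (L_n f)^(p-1), which is L_{n+1}^(p-1) because p - 1 is
    even. *)
Lemma dickson_q0_dvd n (F : {mpoly 'F_p[n]}) :
  GL_invariant F -> (forall i, exists G, F = G * 'X_i) ->
  exists G, F = G * dickson_q p n 0.
Proof.
elim: n F => [|n ih] F invF dvdF.
  exists F; rewrite dickson_q0 // /dickson_L /bracket det_mx00 expr1n.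
  by rewrite mulr1.
have [A FA] : exists A, uni0 F = dickson_q p n 0 *: A.
  apply: coef_dvd_scale => k; apply: ih => [|i]; first exact: coef_uni0_invariant.
  have [G ->] := dvdF (lift ord0 i); exists (uni0 G)`_k.
  by rewrite uni0M uni0Xlift coefMC.
have [|||B AB] := @form_prod_exp_dvd n (uni0 F).
- move=> v; rewrite -uni0_gl_shift; congr uni0; apply: invF.
  by rewrite unitmxE det_gl_block mul1r -unitmxE unitmx1.
- move=> a a0.
  have gU : gl_block a 0 0 (1%:M : 'M_n) \in unitmx.
    by rewrite unitmxE det_gl_block det1 mulr1 unitfE.
  rewrite -{2}(invF _ gU) -/(gl_tuple _) uni0_gl_block linform0 addr0.
  congr (_ \Po _).
  by rewrite (eq_map_poly (@comp_gl_tuple1 p n)) map_poly_id.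
- by have [G ->] := dvdF ord0; rewrite uni0M uni0X0 coefMX eqxx.
rewrite FA in AB.
have [|C AC] := monic_dvd_scale _ (dickson_q0_neq0 p_prime n) AB.
  exact: monic_exp (form_prod_monic p n).
have [G CG] := uni0_surj C; exists G; apply: uni0_inj.
rewrite FA AC CG uni0M (dickson_q0 p_prime n.+1) rmorphXn /= uni0_L_form_prod //.
rewrite exprZn exprMn (sign_exp_even _ _ (odd_pred p_odd)) mul1r.
by rewrite -dickson_q0 // scalerAr.
Qed.

(** The transposition of the first variable with variable [i] carries divisibility by one to
    divisibility by the other. *)
Lemma invariant_dvdX n (F : {mpoly 'F_p[n.+1]}) i : GL_invariant F ->
  (uni0 F)`_0 = 0 -> exists G, F = G * 'X_i.
Proof.
move=> invF /poly_root0[B FB]; have [G BG] := uni0_surj B.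
have {BG} FG : F = G * 'X_ord0 by apply: uni0_inj; rewrite uni0M uni0X0 FB BG.
pose g : 'M['F_p]_n.+1 := perm_mx (tperm ord0 i).
exists (G \mPo gl_tuple g); rewrite -{1}(invF g (unitmx_perm _ _)) -/(gl_tuple g) FG.
rewrite (rmorphM (comp_mpoly _)) /= comp_gl_tupleX (bigD1 i) //=.
rewrite !mxE tpermL eqxx scale1r big1 ?addr0 // => j /negbTE ji.
by rewrite !mxE tpermL eq_sym ji scale0r.
Qed.

Lemma GL_invariant_div n (F G H : {mpoly 'F_p[n]}) : G != 0 ->
  GL_invariant F -> GL_invariant G -> F = H * G -> GL_invariant H.
Proof.
move=> G0 invF invG FHG g gU; apply: (mulIf G0).
rewrite -[X in _ * X](invG g gU) -[RHS]FHG -[RHS](invF g gU) FHG.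
by apply/esym; exact: (rmorphM (comp_mpoly (gl_tuple g))).
Qed.

Lemma invariant_split n (F : {mpoly 'F_p[n.+1]}) : GL_invariant F ->
  (uni0 F)`_0 = 0 -> exists2 G, GL_invariant G & F = G * dickson_q p n.+1 0.
Proof.
move=> invF F0; have [i|G FG] := dickson_q0_dvd invF; first exact: invariant_dvdX.
exists G => //; apply: GL_invariant_div FG => //; first exact: dickson_q0_neq0.
exact: dickson_q_invariant.
Qed.

(* Invariance under [x_j |-> x_j + x_0], read modulo [x_0 ^+ 2], kills every
   partial derivative of the restriction. *)
Lemma restriction_pth_power n (F : {mpoly 'F_p[n.+1]}) : GL_invariant F ->
  exists2 H, GL_invariant H & (uni0 F)`_0 = H ^+ p.
Proof.
move=> invF; have inv0 := coef_uni0_invariant 0 invF.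
have [j|H FH] := mderiv_pth_root (F := (uni0 F)`_0) p_prime.
  have gU : gl_block 1 0 (delta_mx j 0) (1%:M : 'M['F_p]_n) \in unitmx.
    rewrite unitmxE (_ : \det _ = 1) ?unitr1 //.
    by have := det_lblock (1%:M : 'M['F_p]_1) (delta_mx j 0) 1%:M; rewrite !det1 mul1r.
  have [_] := uni0_gl_column F (delta_mx j 0).
  have -> : F \mPo gl_tuple (gl_block 1 0 (delta_mx j 0) 1%:M) = F by exact: invF gU.
  move/eqP; rewrite -subr_eq0 opprD addNKr oppr_eq0 (bigD1 j) //= mxE !eqxx scale1r.
  rewrite big1 ?addr0 => [/eqP //|k /negbTE kj].
  by rewrite mxE kj scale0r.
(* The p-th root inherits invariance, since p-th roots are unique in a domain of characteristic
   p. *)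
exists H => [g gU|//]; apply: (expf_pchar_inj (pchar_mpoly p_prime n)).
rewrite -[RHS]FH -[RHS](inv0 g gU) FH.
by apply/esym; exact: (rmorphXn (comp_mpoly (gl_tuple g))).
Qed.

End Divisibility.

(** * Generation of the invariants *)

(** [msize] is the total degree plus one and is 0 at the zero polynomial, so bounds of the form
    [a.+1] express degree at most a with zero included. *)
Lemma msizeM_bound n (R : idomainType) (F G : {mpoly R[n]}) a b :
  (msize F <= a.+1)%N -> (msize G <= b.+1)%N -> (msize (F * G) <= (a + b).+1)%N.
Proof.
have [->|F0] := eqVneq F 0; first by rewrite mul0r msize0.
have [->|G0] := eqVneq G 0; first by rewrite mulr0 msize0.
rewrite msizeM //; move: (msize F) (msize G) => x y; lia.
Qed.

Lemma msizeD_bound n (R : nzRingType) (F G : {mpoly R[n]}) a :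
  (msize F <= a)%N -> (msize G <= a)%N -> (msize (F + G) <= a)%N.
Proof. by move=> Fa Ga; rewrite (leq_trans (msizeD_le _ _)) // geq_max Fa. Qed.

Lemma dhomog_msizeE n (R : nzRingType) d (F : {mpoly R[n]}) :
  F \is d.-homog -> F != 0 -> msize F = d.+1.
Proof.
by move=> Fd F0; rewrite -mlead_deg // (dhomog_mf Fd (mlead_supp F0)).
Qed.

Lemma dhomog_prod_ord n (R : comNzRingType) m (d : 'I_m -> nat)
    (F : 'I_m -> {mpoly R[n]}) : (forall i, F i \is (d i).-homog) ->
  \prod_i F i \is (\sum_i d i)%N.-homog.
Proof.
move=> Fd; apply: (big_ind2 (fun F d => F \is d.-homog)) => [|G e H h|i _].
- exact: dhomog1.
- exact: dhomogM.
exact: Fd.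
Qed.

Lemma msize_uni0_coef0 n (R : idomainType) (F : {mpoly R[n.+1]}) :
  (msize (uni0 F)`_0 <= msize F)%N.
Proof.
rewrite {1}[F]mpolyE rmorph_sum coef_sum big_seq.
apply: (big_ind (fun G => (msize G <= msize F)%N)) => [||m mF].
- by rewrite msize0.
- by move=> G H; exact: msizeD_bound.
rewrite /= uni0Z coefZ mul_mpolyC (leq_trans (msizeZ_le _ _)) //.
apply: leq_trans (msize_mdeg_lt mF); rewrite mpolyXE_id rmorph_prod -horner_coef0.
rewrite -/(horner_eval 0 _) rmorph_prod /= mdegE.
apply: (big_ind2 (fun G d => (msize G <= d.+1)%N)) => [|G a H b|i _].
- by rewrite msize1.
- exact: msizeM_bound.
rewrite /horner_eval rmorphXn /= horner_exp.
elim: (m i) => [|k ih]; first by rewrite expr0 msize1.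
rewrite exprS -[k.+1]add1n; apply: msizeM_bound ih.
case: (unliftP ord0 i) => [j ->|->].
  by rewrite uni0Xlift hornerC msizeX mdeg1.
by rewrite uni0X0 hornerX msize0.
Qed.

Lemma coef0D_eq (R : comNzRingType) (A B : {poly R}) a b :
  A`_0 = a -> B`_0 = b -> (A + B)`_0 = a + b.
Proof. by rewrite coefD => -> ->. Qed.

Lemma coef0M_eq (R : comNzRingType) (A B : {poly R}) a b :
  A`_0 = a -> B`_0 = b -> (A * B)`_0 = a * b.
Proof. by move=> <- <-; rewrite -!horner_coef0 hornerM. Qed.

Lemma coef0B_eq0 (R : comNzRingType) (A B : {poly R}) a :
  A`_0 = a -> B`_0 = a -> (A - B)`_0 = 0.
Proof. by rewrite coefB => -> ->; rewrite subrr. Qed.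

Section DicksonTheorem.
Variables (p : nat) (p_prime : prime p) (p_odd : odd p).

Lemma bracket_homog n (e : 'I_n -> nat) : bracket p e \is (\sum_j p ^ e j)%N.-homog.
Proof.
apply: rpred_sum => s _.
have -> : (\sum_j p ^ e j = \sum_i p ^ e (s i))%N.
  by rewrite (reindex_inj (@perm_inj _ s)).
have h : \prod_i (\matrix_(r, j) 'X_r ^+ (p ^ e j) : 'M[{mpoly 'F_p[n]}]_n) i (s i)
    \is (\sum_i p ^ e (s i))%N.-homog.
  apply: dhomog_prod_ord => i; rewrite mxE -[X in X.-homog]mul1n.
  by apply: dhomogMn; rewrite dhomogX; apply/eqP; exact: mdeg1.
case: (odd_perm s); last by rewrite expr0 mul1r.
by rewrite expr1 mulN1r dhomogN.
Qed.

(** Both sides add up p^j for j from 0 to n. *)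
Lemma sum_bump n s : (s <= n)%N ->
  (\sum_(j < n) p ^ bump s j + p ^ s = \sum_(j < n) p ^ j + p ^ n)%N.
Proof.
rewrite -ltnS => sn; rewrite -(big_ord_recr _ (fun j => p ^ j)%N) /=.
by rewrite (bigD1_ord (Ordinal sn)) //= addnC.
Qed.

Lemma msize_dickson_q n s : (s <= n)%N -> dickson_q p n s != 0 ->
  msize (dickson_q p n s) = (p ^ n - p ^ s).+1.
Proof.
move=> sn q0; have L0 := dickson_L_neq0 p_prime n.
have Ls0 : dickson_Ls p n s != 0 by rewrite -dickson_qL // mulf_neq0.
have sL : msize (dickson_L p n) = (\sum_(j < n) p ^ j).+1.
  exact: dhomog_msizeE (bracket_homog (fun j : 'I_n => j)) L0.
have sLs : msize (dickson_Ls p n s) = (\sum_(j < n) p ^ bump s j).+1.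
  exact: dhomog_msizeE (bracket_homog (fun j : 'I_n => bump s j)) Ls0.
have e : msize (dickson_Ls p n s) =
    (msize (dickson_q p n s) + msize (dickson_L p n)).-1.
  exact: etrans (congr1 (fun F : {mpoly 'F_p[n]} => msize F)
    (esym (dickson_qL p_prime sn))) (msizeM q0 L0).
move: (etrans (esym sLs) e) sL (sum_bump sn) (leq_pexp2l (prime_gt0 p_prime) sn).
move: (msize (dickson_q p n s)) (msize (dickson_L p n)) => x y.
move: (\sum_(j < n) p ^ bump s j)%N (\sum_(j < n) p ^ j)%N => z t; lia.
Qed.

(* [dickson_gen n d F]: [F] is a polynomial in the [dickson_q p n s] of weighted
   degree at most [d], where [dickson_q p n s] has weight [p ^ n - p ^ s]. *)
Inductive dickson_gen n : nat -> {mpoly 'F_p[n]} -> Prop :=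
| dickson_genC d c : dickson_gen d c%:MP
| dickson_gen_q s : (s < n)%N -> dickson_gen (p ^ n - p ^ s) (dickson_q p n s)
| dickson_genD d F G : dickson_gen d F -> dickson_gen d G -> dickson_gen d (F + G)
| dickson_genM d e F G :
    dickson_gen d F -> dickson_gen e G -> dickson_gen (d + e) (F * G)
| dickson_gen_le d e F : (d <= e)%N -> dickson_gen d F -> dickson_gen e F.

Lemma GL_invariantC n c : GL_invariant (c%:MP : {mpoly 'F_p[n]}).
Proof. by move=> g _; exact: comp_mpolyC. Qed.

Lemma GL_invariantD n (F G : {mpoly 'F_p[n]}) :
  GL_invariant F -> GL_invariant G -> GL_invariant (F + G).
Proof. by move=> iF iG g gU; rewrite comp_mpolyD iF // iG. Qed.

Lemma GL_invariantB n (F G : {mpoly 'F_p[n]}) :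
  GL_invariant F -> GL_invariant G -> GL_invariant (F - G).
Proof. by move=> iF iG g gU; rewrite comp_mpolyB iF // iG. Qed.

Lemma GL_invariantM n (F G : {mpoly 'F_p[n]}) :
  GL_invariant F -> GL_invariant G -> GL_invariant (F * G).
Proof.
move=> iF iG g gU; rewrite -[in RHS](iF g gU) -[in RHS](iG g gU).
exact: (rmorphM (comp_mpoly (gl_tuple g))).
Qed.

Lemma dickson_gen_invariant n d (F : {mpoly 'F_p[n]}) :
  dickson_gen d F -> GL_invariant F.
Proof.
elim=> {d F} [d c|s sn|d F G _ iF _ iG|d e F G _ iF _ iG|//].
- exact: GL_invariantC.
- exact: dickson_q_invariant (ltnW sn).
- exact: GL_invariantD.
exact: GL_invariantM.
Qed.

Lemma dickson_gen_msize n d (F : {mpoly 'F_p[n]}) :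
  dickson_gen d F -> (msize F <= d.+1)%N.
Proof.
elim=> {d F} [d c|s sn|d F G _ iF _ iG|d e F G _ iF _ iG|d e F de _ iF].
- by rewrite msizeC; case: (c != 0).
- have [->|q0] := eqVneq (dickson_q p n s) 0; first by rewrite msize0.
  by rewrite msize_dickson_q ?(ltnW sn).
- exact: msizeD_bound.
- exact: msizeM_bound.
exact: leq_trans iF _.
Qed.

(** Replace Q_{n,s} by Q_{n+1,s+1}: it restricts to the p-th power of Q_{n,s}, and its weight is p
    times as large. Frobenius is additive and fixes the constants. *)
Lemma dickson_gen_lift n d (H : {mpoly 'F_p[n]}) : dickson_gen d H ->
  exists2 F : {mpoly 'F_p[n.+1]}, dickson_gen (p * d) F & (uni0 F)`_0 = H ^+ p.
Proof.
have chP := pchar_mpoly p_prime n.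
elim=> {d H} [d c|s sn|d F G _ [F' gF eF] _ [G' gG eG]|
  d e F G _ [F' gF eF] _ [G' gG eG]|d e F de _ [F' gF eF]].
- exists c%:MP; first exact: dickson_genC.
  by rewrite uni0C coefC eqxx -rmorphXn /= Fp_exp_p.
- exists (dickson_q p n.+1 s.+1); last exact: dickson_q_restrict.
  by rewrite mulnBr -!expnS; exact: dickson_gen_q.
- exists (F' + G'); first exact: dickson_genD.
  rewrite uni0D; apply: etrans (coef0D_eq eF eG) _; apply/esym/exprDn_pchar.
  by rewrite (pnatE _ p_prime).
- exists (F' * G'); first by rewrite mulnDr; exact: dickson_genM.
  by rewrite uni0M exprMn; exact: coef0M_eq.
by exists F' => //; apply: dickson_gen_le gF; rewrite leq_mul2l de orbT.
Qed.

(** The weight bound is part of the claim because the inner induction needs it: H has degree at most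
    d / p, so its lift F' has degree at most d, and dividing F - F' by Q_0 strictly lowers the
    degree. *)
Lemma invariant_dickson_gen n d (F : {mpoly 'F_p[n]}) :
  GL_invariant F -> (msize F <= d.+1)%N -> dickson_gen d F.
Proof.
elim: n d F => [|n ihn] d F.
  by move=> _ _; rewrite (nvar0_mpolyC F); exact: dickson_genC.
have [m] := ubnP d; elim: m d F => // m ihm d F dm invF Fd.
have [H invH FH] := restriction_pth_power p_prime invF.
have gH : dickson_gen (d %/ p) H.
  apply: ihn => //; have [->|H0] := eqVneq H 0; first by rewrite msize0.
  have := msize_exp_idomain p H0; have := leq_trans (msize_uni0_coef0 F) Fd.
  rewrite FH => h1 h2.
  have : ((msize H).-1 <= d %/ p)%N.
    rewrite leq_divRL ?prime_gt0 // -h2; move: h1.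
    by case: (msize (H ^+ p)).
  by case: (msize H).
have [F' gF' F'H] := dickson_gen_lift gH.
have {}gF' : dickson_gen d F' by apply: dickson_gen_le gF'; rewrite mulnC leq_trunc_div.
have [||G invG FG] := invariant_split p_prime p_odd (F := F - F').
- by apply: GL_invariantB => //; exact: dickson_gen_invariant gF'.
- have -> : uni0 (F - F') = uni0 F - uni0 F' by exact: rmorphB.
  exact: coef0B_eq0 FH F'H.
have -> : F = F' + G * dickson_q p n.+1 0 by rewrite -FG addrC subrK.
apply: dickson_genD => //.
have [->|G0] := eqVneq G 0; first by rewrite mul0r -mpolyC0; exact: dickson_genC.
have q0 := dickson_q0_neq0 p_prime n.+1.
have sG : (msize G + (p ^ n.+1 - p ^ 0) <= d.+1)%N.
  have : (msize (F - F') <= d.+1)%N.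
    apply: msizeD_bound => //; rewrite msizeN.
    exact: dickson_gen_msize gF'.
  by rewrite FG msizeM // msize_dickson_q // addnS.
have q1 : (0 < p ^ n.+1 - p ^ 0)%N by rewrite subn_gt0 ltn_exp2l ?prime_gt1.
have G1 : (0 < msize G)%N by rewrite lt0n msize_poly_eq0.
(* As [G] is nonzero, the degree of Q_0 is at most d and the truncated subtraction is exact. *)
have dE : (d = (d - (p ^ n.+1 - p ^ 0)) + (p ^ n.+1 - p ^ 0))%N.
  by move: sG q1 G1; move: (msize G) (p ^ n.+1 - p ^ 0)%N => x y; lia.
rewrite dE; apply: dickson_genM; last exact: dickson_gen_q.
apply: ihm => //; move: sG q1 G1 dm; move: (msize G) (p ^ n.+1 - p ^ 0)%N => x y; lia.
Qed.

Definition dickson_tuple n : n.-tuple {mpoly 'F_p[n]} :=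
  [tuple dickson_q p n s | s < n].

Lemma comp_dickson_tupleX n (s : 'I_n) :
  'X_s \mPo dickson_tuple n = dickson_q p n s.
Proof. by rewrite comp_mpolyXU -tnth_nth tnth_mktuple. Qed.

Lemma dickson_gen_comp n d (F : {mpoly 'F_p[n]}) : dickson_gen d F ->
  exists G, F = G \mPo dickson_tuple n.
Proof.
elim=> {d F} [d c|s sn|d _ _ _ [F ->] _ [G ->]|d e _ _ _ [F ->] _ [G ->]|//].
- by exists c%:MP; rewrite comp_mpolyC.
- by exists 'X_(Ordinal sn); rewrite comp_dickson_tupleX.
- by exists (F + G); rewrite comp_mpolyD.
exists (F * G); apply/esym; exact: (rmorphM (comp_mpoly (dickson_tuple n))).
Qed.

Lemma GL_invariant_comp n (F : {mpoly 'F_p[n]}) :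
  GL_invariant F <-> exists G, F = G \mPo dickson_tuple n.
Proof.
split=> [invF|[G ->]].
  exact: dickson_gen_comp (invariant_dickson_gen invF (leqnSn _)).
elim/mpoly_ring_ind: G => [c|s|F1 F2|F1 F2].
- by rewrite comp_mpolyC; exact: GL_invariantC.
- by rewrite comp_dickson_tupleX; apply: dickson_q_invariant => //; exact: ltnW.
- by rewrite comp_mpolyD; exact: GL_invariantD.
move=> i1 i2; have -> : F1 * F2 \mPo dickson_tuple n =
  (F1 \mPo dickson_tuple n) * (F2 \mPo dickson_tuple n) by exact: rmorphM.
exact: GL_invariantM.
Qed.

End DicksonTheorem.

(** * Algebraic independence *)

Lemma msize_mderiv_lt n (R : nzRingType) (F : {mpoly R[n]}) i :
  F != 0 -> (msize F^`M(i) < msize F)%N.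
Proof.
move=> F0; have [->|dF0] := eqVneq F^`M(i) 0.
  by rewrite msize0 lt0n msize_poly_eq0.
rewrite -mlead_deg //; have := mlead_supp dF0; move: (mlead _) => m.
rewrite mcoeff_msupp mcoeff_mderiv => mF.
have : (m + U_(i))%MM \in msupp F.
  by rewrite mcoeff_msupp; apply: contraNneq mF => ->; rewrite mul0rn.
by move/msize_mdeg_lt; rewrite mdegD mdeg1 addn1.
Qed.

Lemma euler_mpoly n (R : comNzRingType) d (F : {mpoly R[n]}) : F \is d.-homog ->
  \sum_(i < n) F^`M(i) * 'X_i = d%:R *: F.
Proof.
move=> Fd; rewrite [F in RHS]mpolyE scaler_sumr.
transitivity (\sum_(i < n) \sum_(m <- msupp F) (m i)%:R *: (F@_m *: 'X_[m])).
  apply: eq_bigr => i _; rewrite {1}[F]mpolyE linear_sum /= mulr_suml.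
  apply: eq_bigr => m _; rewrite linearZ /= mderivX -scalerAl.
  rewrite [RHS]scalerA [in RHS]mulrC -[RHS]scalerA; congr (_ *: _).
  have [->|mi] := posnP (m i); first by rewrite mulr0n !scale0r mul0r.
  rewrite -scalerAl -mpolyXD submK //.
  by apply/mnm_lepP => j; rewrite mnm1E; case: eqP => [<-|].
rewrite exchange_big !big_seq; apply: eq_bigr => m mF.
have md : mdeg m = d by exact: dhomog_mf Fd m mF.
by rewrite -scaler_suml -md mdegE natr_sum.
Qed.

Lemma sign_pred (R : nzRingType) n : (0 < n)%N -> (-1) ^+ n = - (-1) ^+ n.-1 :> R.
Proof. by case: n => // n _; rewrite exprS mulN1r. Qed.

Lemma sum_single (R : nmodType) n (s : 'I_n) (a : 'I_n -> R) :
  (forall i, i != s -> a i = 0) -> \sum_i a i = a s.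
Proof. by move=> a0; rewrite (bigD1 s) //= big1 ?addr0. Qed.

Lemma mulIf_eq0 (R : idomainType) (x y : R) : y != 0 -> x * y = 0 -> x = 0.
Proof. by move=> /negbTE y0 /eqP; rewrite mulf_eq0 y0 orbF => /eqP. Qed.

Section Steenrod.
Variables (p : nat) (p_prime : prime p).

(** The product rule applied to Q_s L_n = L_{n,s}, which avoids differentiating fractions. *)
Lemma power_der_L_q n k s : (s <= n)%N ->
  power_der k (dickson_q p n s) * dickson_L p n =
  power_der k (dickson_Ls p n s) - dickson_q p n s * power_der k (dickson_L p n).
Proof.
move=> sn; have [_ DM] := @power_der_derivation p n k.
apply: (canRL (addrK _)); rewrite -DM.
exact: congr1 (dickson_qL p_prime sn).
Qed.

Lemma power_der_L n k : (0 < k <= n)%N ->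
  power_der k (dickson_L p n) =
  if k == n then (-1) ^+ n.-1 * (dickson_q p n 0 * dickson_L p n) else 0.
Proof.
move=> kn; rewrite -dickson_Ls_top (power_der_Ls p_prime kn (leqnn n)).
by rewrite dickson_Ls_top (dickson_qL p_prime (leq0n n)).
Qed.

Lemma power_der_q n k s : (0 < k < n)%N -> (s <= n)%N ->
  power_der k (dickson_q p n s) =
  if k == s then (-1) ^+ k.-1 * dickson_q p n 0 else 0.
Proof.
case/andP=> k0 kn sn; have kn' : (0 < k <= n)%N by rewrite k0 ltnW.
apply: (mulIf (dickson_L_neq0 p_prime n)).
apply: etrans (power_der_L_q _ sn) _.
have e : power_der k (dickson_Ls p n s) =
    (if k == s then (-1) ^+ k.-1 * dickson_q p n 0 else 0) * dickson_L p n.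
  rewrite (power_der_Ls p_prime kn' sn) -(dickson_qL p_prime (leq0n n)).
  by case: eqP => [<-|_]; rewrite ?mul0r // mulrA.
apply: etrans (congr2 (fun x y => x - dickson_q p n s * y) e (power_der_L kn')) _.
by rewrite (ltn_eqF kn) mulr0 subr0.
Qed.

Lemma power_der_top_q n s : (s < n)%N ->
  power_der n (dickson_q p n s) = (-1) ^+ n * dickson_q p n 0 * dickson_q p n s.
Proof.
move=> sn; have n0 : (0 < n <= n)%N by rewrite leqnn (leq_ltn_trans _ sn).
apply: (mulIf (dickson_L_neq0 p_prime n)).
apply: etrans (power_der_L_q _ (ltnW sn)) _.
have e : power_der n (dickson_Ls p n s) = 0.
  by rewrite (power_der_Ls p_prime n0 (ltnW sn)) (gtn_eqF sn).
apply: etrans (congr2 (fun x y => x - dickson_q p n s * y) e (power_der_L n0)) _.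
rewrite eqxx sub0r (sign_pred _ (leq_ltn_trans (leq0n s) sn)).
move: ((-1) ^+ n.-1) (dickson_q p n 0) (dickson_q p n s) (dickson_L p n) => a x y z.
by rewrite !mulNr mulrCA !mulrA [a * y * _]mulrAC.
Qed.

Lemma power_der_comp n k (G : {mpoly 'F_p[n]}) :
  power_der k (G \mPo dickson_tuple p n) =
  \sum_(s < n) (G^`M(s) \mPo dickson_tuple p n) * power_der k (dickson_q p n s).
Proof.
rewrite {1}/comp_mpoly (derivation_mmap (@power_der_derivation p n k)).
  by apply: eq_bigr => s _; rewrite tnth_mktuple.
exact: power_derC.
Qed.

(** By the chain rule, the eigenvector property of the Q_s turns the derivative into the Euler sum
    of [G]. *)
Lemma power_der_top_comp n d (G : {mpoly 'F_p[n]}) : G \is d.-homog ->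
  power_der n (G \mPo dickson_tuple p n) =
  (-1) ^+ n * dickson_q p n 0 * (d%:R * (G \mPo dickson_tuple p n)).
Proof.
move=> Gd; rewrite power_der_comp.
have <- : (d%:R *: G) \mPo dickson_tuple p n = d%:R * (G \mPo dickson_tuple p n).
  by rewrite comp_mpolyZ scaler_nat mulr_natl.
rewrite -(euler_mpoly Gd) raddf_sum mulr_sumr; apply: eq_bigr => s _.
rewrite (power_der_top_q (ltn_ord s)) mulrCA; congr (_ * _).
transitivity ((G^`M(s) \mPo dickson_tuple p n) * ('X_s \mPo dickson_tuple p n)).
  by rewrite comp_dickson_tupleX.
by apply/esym; exact: (rmorphM (comp_mpoly (dickson_tuple p n))).
Qed.

(* The derivations [power_der k], [0 < k <= n], make the Jacobian of the
   [dickson_q p n s] invertible, so the partial derivatives of a relation are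
   relations; a relation without nonzero derivatives is a [p]-th power. *)
Lemma comp_dickson_inj n (G : {mpoly 'F_p[n]}) :
  G \mPo dickson_tuple p n = 0 -> G = 0.
Proof.
have [m] := ubnP (msize G); elim: m G => // m ihm G Gm Gt0.
apply/eqP; apply/negPn/negP => G0.
have q0 := dickson_q0_neq0 p_prime n.
have dGt k : \sum_(s < n) (G^`M(s) \mPo dickson_tuple p n) *
    power_der k (dickson_q p n s) = 0.
  by rewrite -power_der_comp Gt0 derivation0 //; exact: power_der_derivation.
(* For 0 < s < n, D_s is nonzero on Q_s only, so the chain rule leaves a single term. *)
have dt_gt0 (s : 'I_n) : (0 < s)%N -> G^`M(s) \mPo dickson_tuple p n = 0.
  move=> s0; have sn : (0 < s < n)%N by rewrite s0 ltn_ord.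
  have e : (G^`M(s) \mPo dickson_tuple p n) * power_der s (dickson_q p n s) = 0.
    rewrite -(dGt s); apply/esym; apply: (sum_single (s := s)) => i /negbTE i_s.
    rewrite (power_der_q sn (ltnW (ltn_ord i))).
    have -> : (s == i :> nat) = false by rewrite val_eqE eq_sym.
    exact: mulr0.
  move: e; rewrite (power_der_q sn (ltnW (ltn_ord s))) eqxx; apply: mulIf_eq0.
  by apply: (mulf_neq0 _ q0); rewrite signr_eq0.
have dt (s : 'I_n) : G^`M(s) \mPo dickson_tuple p n = 0.
  (* For s = 0, D_n is used: the terms of positive index are already known to vanish. *)
  have [s0|s0] := posnP s; last exact: dt_gt0.
  have e : (G^`M(s) \mPo dickson_tuple p n) * power_der n (dickson_q p n s) = 0.
    rewrite -(dGt n); apply/esym; apply: (sum_single (s := s)) => i i_s.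
    rewrite dt_gt0 ?mul0r // lt0n; apply: contraNneq i_s => i0.
    by rewrite -val_eqE /= i0 s0.
  move: e; rewrite (power_der_top_q (ltn_ord s)) s0; apply: mulIf_eq0.
  by apply: (mulf_neq0 _ q0); apply: (mulf_neq0 _ q0); rewrite signr_eq0.
have dG0 s : G^`M(s) = 0.
  by apply: ihm (dt s); apply: leq_trans (msize_mderiv_lt s G0) _.
have [H GH] := mderiv_pth_root p_prime dG0.
have Ht0 : H \mPo dickson_tuple p n = 0.
  have : (H \mPo dickson_tuple p n) ^+ p = 0.
    by rewrite -(rmorphXn (comp_mpoly (dickson_tuple p n))) -GH.
  by move/eqP; rewrite expf_eq0 => /andP[_ /eqP].
have H0 : H != 0.
  by apply: contraNneq G0 => H0; rewrite GH H0 expr0n eqn0Ngt prime_gt0.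
(* Since deg G = p deg H, the root is smaller unless [G] is constant, and a constant relation is
   zero. *)
have [HG|GH1] := ltnP (msize H) (msize G).
  by move: H0; rewrite (ihm H) ?eqxx //; apply: leq_trans HG _.
have sG : (msize G <= 1)%N.
  have := msize_exp_idomain p H0; rewrite -GH; have := prime_gt1 p_prime.
  move: GH1; move: (msize G) (msize H) => a b; nia.
by move: G0 Gt0; rewrite (msize1_polyC sG) comp_mpolyC => /eqP.
Qed.

End Steenrod.

(** * The auxiliary grading *)

(** Extending a family by zero outside [I] replaces a sum over [I] by a full sum, to which
    additivity and directness apply. *)
Lemma family_sumP (M : zmodType) (V : nat -> M -> Prop) (I : pred nat) (x : M) :
  (forall d, V d 0) ->
  family_sum V I x <-> exists N (y : nat -> M), (forall d, V d (y d)) /\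
    (forall d, ~~ I d -> y d = 0) /\ x = \sum_(0 <= d < N) y d.
Proof.
move=> V0; split=> [[N [y [Vy ->]]]|[N [y [Vy [Iy ->]]]]].
  exists N, (fun d => if I d then y d else 0); split=> [d|].
    by case: ifP => [/Vy|].
  by split=> [d /negbTE ->|] //; rewrite big_mkcond.
exists N, y; split=> [d _|]; first exact: Vy.
rewrite [RHS]big_mkcond; apply: eq_bigr => d _.
by case: ifPn => // /Iy.
Qed.

Lemma tofrac_sign_nat (R : idomainType) n d (x y : R) :
  ((-1) ^+ n * x * (d%:R * y))%:F = (-1) ^+ n * x%:F * (d%:R * y%:F).
Proof. by rewrite !tofracM tofracXn tofracN tofrac1 rmorph_nat. Qed.

Lemma mul_signK (R : comNzRingType) n (x y z : R) :
  (-1) ^+ n * x * ((-1) ^+ n * y * z) = x * y * z.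
Proof. by rewrite mulrACA [x * _]mulrC -!mulrA signrMK. Qed.

Section Main.
Variables (p n : nat) (p_prime : prime p) (p_odd : odd p) (n_gt0 : (0 < n)%N).

Local Notation P := {mpoly 'F_p[n]}.
Local Notation K := {fraction P}.
Local Notation piece := (@dickson_piece p n).

Lemma dickson_QE s : (s <= n)%N -> dickson_Q p n s = (dickson_q p n s)%:F.
Proof.
move=> sn; rewrite /dickson_Q -(dickson_qL p_prime sn) tofracM mulfK //.
by rewrite tofrac_eq0 dickson_L_neq0.
Qed.

Lemma dickson_evalE (G : P) : dickson_eval G = (G \mPo dickson_tuple p n)%:F.
Proof.
pose f := mmap (@FracField.tofrac P \o @mpolyC n 'F_p) (fun s : 'I_n => dickson_Q p n s).
pose g := @FracField.tofrac P \o comp_mpoly (dickson_tuple p n).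
apply: (eq_mpoly_rmorph (f := f) (g := g)) => [c|s].
  by rewrite /f /g /= mmapC comp_mpolyC.
rewrite /f /g /= mmapX mmap1U comp_dickson_tupleX dickson_QE //.
exact: ltnW.
Qed.

Lemma dickson_pieceE d x :
  piece d x <-> exists2 G : P, G \is d.-homog & x = (G \mPo dickson_tuple p n)%:F.
Proof. by split=> -[G Gd ->]; exists G; rewrite ?dickson_evalE. Qed.

Lemma dickson_piece0 d : piece d 0.
Proof.
by apply/dickson_pieceE; exists 0; rewrite ?dhomog0 // comp_mpoly0 tofrac0.
Qed.

Lemma dickson_pieceZ d (c : 'F_p) x : piece d x -> piece d ((c%:MP)%:F * x).
Proof.
move=> /dickson_pieceE[G Gd ->]; apply/dickson_pieceE; exists (c *: G).
  exact: dhomogZ.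
by rewrite comp_mpolyZ -mul_mpolyC tofracM.
Qed.

Lemma natK (d : nat) : d%:R = (((d%:R : 'F_p)%:MP : P)%:F) :> K.
Proof. by rewrite mpolyC_nat rmorph_nat. Qed.

Lemma natK_eq0 (d : nat) : ((d%:R : K) == 0) = (p %| d)%N.
Proof.
rewrite natK tofrac_eq0 mpolyC_eq0.
by rewrite -(dvdn_pcharf (pchar_Fp p_prime)).
Qed.

(** Algebraic independence of the Q_s lifts the relation to homogeneous polynomials of distinct
    degrees, where taking the component of degree [d] isolates one term. *)
Lemma dickson_piece_independent : independent piece.
Proof.
move=> N y Vy y0 d dN.
have VyE (i : 'I_N) : exists G : P,
    G \is i.-homog /\ y i = (G \mPo dickson_tuple p n)%:F.
  by have /dickson_pieceE[G] := Vy i; exists G.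
have [G GP] := fin_all_exists VyE.
have sG : \sum_(i < N) G i = 0.
  apply: (comp_dickson_inj p_prime (n := n)); apply/eqP.
  rewrite -tofrac_eq0 (raddf_sum (comp_mpoly _)) raddf_sum; apply/eqP.
  apply: etrans y0; rewrite big_mkord.
  by apply: eq_bigr => i _; have [_ ->] := GP i.
have [Gd ->] := GP (Ordinal dN).
suff -> : G (Ordinal dN) = 0 by rewrite comp_mpoly0 tofrac0.
have := congr1 (pihomog mdeg d) sG; rewrite raddf_sum raddf0 (bigD1 (Ordinal dN)) //=.
rewrite pihomog_dE // big1 ?addr0 // => i iN.
have [Gi _] := GP i; apply: pihomog_ne0 Gi.
by rewrite -val_eqE in iN.
Qed.

Lemma dicksonE x : dickson x <-> exists G : P, x = (G \mPo dickson_tuple p n)%:F.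
Proof.
split=> [[F /(GL_invariant_comp p_prime p_odd)[G ->] ->]|[G ->]]; first by exists G.
exists (G \mPo dickson_tuple p n); last exact: erefl.
by apply/(GL_invariant_comp p_prime p_odd); exists G; exact: erefl.
Qed.

Lemma dicksonZ c x : dickson x -> dickson (((c : 'F_p)%:MP : P)%:F * x).
Proof.
move=> /dicksonE[G ->]; apply/dicksonE; exists (c *: G).
by rewrite comp_mpolyZ -mul_mpolyC tofracM.
Qed.

Lemma dickson_of_family (I : pred nat) x : family_sum piece I x -> dickson x.
Proof.
move=> [N [y [Vy ->]]]; apply: (big_ind (@dickson p n)) => [|a b|d /Vy].
- by apply/dicksonE; exists 0; rewrite comp_mpoly0 tofrac0.
- move=> /dicksonE[G ->] /dicksonE[H ->]; apply/dicksonE; exists (G + H).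
  by rewrite comp_mpolyD tofracD.
by move=> /dickson_pieceE[G _ ->]; apply/dicksonE; exists G.
Qed.

Lemma family_of_dickson x : dickson x -> family_sum piece xpredT x.
Proof.
move=> /dicksonE[G ->].
exists (msize G), (fun d => (pihomog mdeg d G \mPo dickson_tuple p n)%:F); split.
  by move=> d _; apply/dickson_pieceE; exists (pihomog mdeg d G) => //; exact: pihomogP.
have e := pihomog_partitionE (leqnn (msize G)).
apply: etrans (congr1 (fun F : P => (F \mPo dickson_tuple p n)%:F) e) _.
by rewrite (raddf_sum (comp_mpoly _)) raddf_sum big_mkord; exact: erefl.
Qed.

Lemma St_derivation : derivation (@St p n).
Proof. exact: fracder_derivation (@St_poly_derivation p n). Qed.

Lemma St_comp d (G : P) : G \is d.-homog ->
  St (G \mPo dickson_tuple p n)%:F =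
  (-1) ^+ n * dickson_Q p n 0 * (d%:R * (G \mPo dickson_tuple p n)%:F).
Proof.
move=> Gd; rewrite /St fracder_tofrac; last exact: St_poly_derivation.
rewrite (_ : St_poly _ = power_der n (G \mPo dickson_tuple p n)); last exact: erefl.
rewrite (power_der_top_comp p_prime Gd) (dickson_QE (leq0n n)).
exact: tofrac_sign_nat.
Qed.

Lemma dickson_Q0_neq0 : dickson_Q p n 0 != 0.
Proof. by rewrite dickson_QE // tofrac_eq0 dickson_q0_neq0. Qed.

Lemma St_delta x : St x = (-1) ^+ n * dickson_Q p n 0 * delta x.
Proof.
by rewrite /delta mul_signK mulfV ?dickson_Q0_neq0 // mul1r.
Qed.

Lemma delta_sum N (y : nat -> K) :
  delta (\sum_(0 <= d < N) y d) = \sum_(0 <= d < N) delta (y d).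
Proof. by rewrite /delta (derivation_sum St_derivation) mulr_sumr. Qed.

Lemma delta_sign k (x : K) : delta ((-1) ^+ k * x) = (-1) ^+ k * delta x.
Proof. by rewrite /delta (derivation_sign St_derivation) mulrCA. Qed.

Lemma St_sign (x : K) : St ((-1) ^+ n * x) = dickson_Q p n 0 * delta x.
Proof. by rewrite St_delta delta_sign -mulrA mulrCA signrMK. Qed.

Lemma delta_piece d x : piece d x -> delta x = d%:R * x.
Proof.
move=> /dickson_pieceE[G Gd ->]; rewrite /delta (St_comp Gd).
by rewrite mul_signK mulVf ?dickson_Q0_neq0 // mul1r.
Qed.

Lemma delta_pieces N (y : nat -> K) : (forall d, piece d (y d)) ->
  delta (\sum_(0 <= d < N) y d) = \sum_(0 <= d < N) d%:R * y d.
Proof.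
by move=> Vy; rewrite delta_sum; apply: eq_bigr => d _; exact: delta_piece.
Qed.

Lemma dickson_piece_natM d k x : piece d x -> piece d (k%:R * x).
Proof. by rewrite natK; exact: dickson_pieceZ. Qed.

(** The scalar by which [delta] acts on the piece of degree d is zero exactly when p divides d;
    directness kills the other components of a kernel element. *)
Lemma delta_kernel x : kernel_on (@dickson p n) (@delta p n) x <->
  family_sum piece (fun d => p %| d)%N x.
Proof.
split=> [[Dx dx0]|fx]; last first.
  split; first exact: dickson_of_family fx.
  case/(family_sumP _ _ dickson_piece0): fx => N [y [Vy [y0 ->]]].
  rewrite delta_pieces // big1 // => d _.
  case: (boolP (p %| d)%N) => [|/y0 ->]; last by rewrite mulr0.
  by rewrite -natK_eq0 => /eqP ->; rewrite mul0r.
case/(family_sumP _ _ dickson_piece0): (family_of_dickson Dx) => N [y [Vy [_ ex]]].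
apply/(family_sumP _ _ dickson_piece0).
exists N, (fun d => if (p %| d)%N then y d else 0); split=> [d|].
  by case: ifP => // _; exact: dickson_piece0.
split=> [d /negbTE -> //|]; rewrite ex !big_mkord; apply: eq_bigr => d _.
case: ifPn => //; rewrite -natK_eq0 => d0.
move: dx0; rewrite ex delta_pieces // => dx0.
have /eqP := dickson_piece_independent
  (fun k => dickson_piece_natM k (Vy k)) dx0 (ltn_ord d).
by rewrite mulf_eq0 (negbTE d0) => /eqP.
Qed.

Lemma delta_image y : image_on (@dickson p n) (@delta p n) y <->
  family_sum piece (fun d => ~~ (p %| d)%N) y.
Proof.
split=> [[x Dx ->]|fy].
  case/(family_sumP _ _ dickson_piece0): (family_of_dickson Dx) => N [z [Vz [_ ->]]].
  rewrite delta_pieces //; apply/(family_sumP _ _ dickson_piece0).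
  exists N, (fun d => d%:R * z d); split=> [d|]; first exact: dickson_piece_natM.
  split=> [d|//]; rewrite negbK -natK_eq0 => /eqP ->; exact: mul0r.
case/(family_sumP _ _ dickson_piece0): fy => N [z [Vz [z0 ->]]].
(* The preimage divides each component by its degree; where p divides d the component is zero, so
   the value given to the inverse of 0 is harmless. *)
pose w d := (((d%:R : 'F_p)^-1%:MP : P)%:F) * z d.
have Vw d : piece d (w d) by exact: dickson_pieceZ.
exists (\sum_(0 <= d < N) w d).
  apply: (dickson_of_family (I := xpredT)).
  by apply/(family_sumP _ _ dickson_piece0); exists N, w.
rewrite delta_pieces //; apply: eq_bigr => d _.
have [pd|pd] := boolP (p %| d)%N; first by rewrite /w z0 ?negbK // !mulr0.
rewrite /w mulrA natK -tofracM -mpolyCM mulfV ?mpolyC1 ?tofrac1 ?mul1r //.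
by rewrite -(dvdn_pcharf (pchar_Fp p_prime)).
Qed.

Lemma St_kernel x : kernel_on (@dickson p n) (@St p n) x <->
  kernel_on (@dickson p n) (@delta p n) x.
Proof.
rewrite /kernel_on St_delta; split=> -[Dx /eqP]; last first.
  by move/eqP => ->; rewrite mulr0.
rewrite mulf_eq0 mulf_eq0 signr_eq0 (negbTE dickson_Q0_neq0) => /eqP.
by split.
Qed.

(** The two operators differ by the factor (-1)^n Q_0; the sign is a scalar of the prime field and
    is absorbed into the preimage. *)
Lemma St_image x : image_on (@dickson p n) (@St p n) x <->
  exists2 y, image_on (@dickson p n) (@delta p n) y & x = dickson_Q p n 0 * y.
Proof.
have Dsign (z : K) : dickson z -> dickson ((-1) ^+ n * z).
  move=> Dz; have -> : (-1) ^+ n = (((-1) ^+ n : 'F_p)%:MP : P)%:F :> K.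
    by rewrite rmorphXn rmorphN1 tofracXn tofracN tofrac1.
  exact: dicksonZ.
split=> [[z Dz ->]|[_ [z Dz ->] ->]].
  exists (delta ((-1) ^+ n * z)); last by rewrite St_delta delta_sign [RHS]mulrCA mulrA.
  by exists ((-1) ^+ n * z); first exact: Dsign.
exists ((-1) ^+ n * z); first exact: Dsign.
exact: esym (St_sign z).
Qed.

End Main.

Theorem theorem4p4 (p n : nat) (p_prime : prime p) (p_odd : odd p)
    (n_gt0 : (0 < n)%N) :
  (independent (@dickson_piece p n) /\
   forall x, dickson x <-> family_sum (@dickson_piece p n) xpredT x) /\
  (forall d (x : {fraction {mpoly 'F_p[n]}}),
     dickson_piece d x -> delta x = d%:R * x) /\
  (forall x, kernel_on (@dickson p n) (@delta p n) x <->
     family_sum (@dickson_piece p n) (fun d => (p %| d)%N) x) /\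
  (forall x, image_on (@dickson p n) (@delta p n) x <->
     family_sum (@dickson_piece p n) (fun d => ~~ (p %| d)%N) x) /\
  (forall x, kernel_on (@dickson p n) (@St p n) x <->
     family_sum (@dickson_piece p n) (fun d => (p %| d)%N) x) /\
  (forall x, image_on (@dickson p n) (@St p n) x <->
     exists2 y, family_sum (@dickson_piece p n) (fun d => ~~ (p %| d)%N) y
              & x = dickson_Q p n 0 * y).
Proof.
split.
  split; first exact: dickson_piece_independent.
  by move=> x; split=> [/family_of_dickson|/dickson_of_family]; exact.
split; first by move=> d x; exact: delta_piece.
split; first by move=> x; exact: delta_kernel.
split; first by move=> x; exact: delta_image.
split; first by move=> x; rewrite (St_kernel p_prime); exact: delta_kernel.
move=> x; rewrite (St_image p_prime p_odd).
by split=> -[y yP ->]; exists y => //; move: yP; rewrite delta_image.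
Qed.
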